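(* Let $\ell$ be an odd prime, let $\gamma=\begin{pmatrix}0&1\\1&0\end{pmatrix}$, and let $\delta\in C_s(\ell)$ be a coset representative of a generator for $C_s(\ell)/(C_s(\ell)\cap\mathrm{SL}_2(\mathbf{Z}/\ell\mathbf{Z}))$. For each subgroup $H\subseteq C_s(\ell)$ not contained in $Z(\ell)$ that is normal in $C_s^+(\ell)$, the group $G_1=\langle H,\gamma\rangle\subseteq C_s^+(\ell)$ satisfies $H=G_1\cap C_s(\ell)$ with $\det(H)=-\det(G_1-H)$. If $H$ satisfies $\det(H)=\det(H\cap Z(\ell))$ and $-1\in H$, then for $e:=[Z(\ell):H\cap Z(\ell)]$, the group $G_2:=\langle H,\gamma\delta^e\rangle\subseteq C_s^+(\ell)$ satisfies $H=G_2\cap C_s(\ell)$ with $\det(H)$ and $-\det(G_2-H)$ disjoint. Up to conjugacy in $\mathrm{GL}_2(\mathbf{Z}/\ell\mathbf{Z})$, this accounts for all subgroups $G$ that lie in the normalizer of a split Cartan group and have dihedral image in $\mathrm{PGL}_2(\mathbf{Z}/\ell\mathbf{Z})$. The total number of such $G$ (up to conjugacy in $\mathrm{GL}_2(\mathbf{Z}/\ell\mathbf{Z})$) is \[\beta(\ell-1)-\tau(\ell-1)+\tau\left(\frac{\ell-1}{2}\right)^2-\tau\left(\frac{\ell-1}{2}\right)-\frac12\left(1+\left(\frac{-1}{\ell}\right)\right)\tau\left(\frac{\ell-1}{4}\right).\]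
   Context: $C_s(\ell)$ is the group of invertible diagonal matrices in $\mathrm{GL}_2(\mathbf{Z}/\ell\mathbf{Z})$ and $C_s^+(\ell):=C_s(\ell)\cup\gamma C_s(\ell)$ is its normalizer. Split Cartan groups are the conjugates of $C_s(\ell)$ in $\mathrm{GL}_2(\mathbf{Z}/\ell\mathbf{Z})$. $Z(\ell)$ is the group of scalar matrices in $\mathrm{GL}_2(\mathbf{Z}/\ell\mathbf{Z})$ and $-1$ denotes the scalar matrix $-I$. For subsets $T$ of $\mathrm{GL}_2(\mathbf{Z}/\ell\mathbf{Z})$, $\det(T)$ is the set of determinants and $-\det(T):=\{-\det g:g\in T\}$; $G-H$ denotes set difference. The non-cyclic group of order $4$ (Klein group) is considered to be dihedral. $\tau(n)$ is the number of positive divisors of $n$, and $\left(\frac{-1}{\ell}\right)$ is the Legendre symbol (when $\ell\equiv3\bmod4$ the last term is $0$). For $n=\prod_p p^{e_p}$, $\beta(n):=\beta_2(n)\prod_{p\ne2}(e_p+1)^2$, where $\beta_2(n):=2(e_2^2-e_2)+3$ if $n$ is even and $\beta_2(n):=1$ if $n$ is odd. *)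

(* Defs.v *)
From HB Require Import structures.
From mathcomp Require Import all_boot all_order all_fingroup all_algebra all_solvable.

Set Implicit Arguments.
Unset Strict Implicit.
Unset Printing Implicit Defensive.

Import GRing.Theory.
Local Open Scope group_scope.
Local Open Scope ring_scope.

(* Z/lZ is represented by 'F_l, which is Z/lZ only when l is prime; all the
   definitions below are meant for such l. *)

Definition scalar_group (l : nat) : {set {'GL_2(l)}} :=
  [set g : {'GL_2(l)} | is_scalar_mx (GLval g)].

Definition diag_cartan (l : nat) : {set {'GL_2(l)}} :=
  [set g : {'GL_2(l)} | is_diag_mx (GLval g)].

Definition SL2 (l : nat) : {set {'GL_2(l)}} :=
  [set g : {'GL_2(l)} | \det (GLval g) == 1].

Definition swap_mx (l : nat) : 'M['F_l]_2 := \matrix_(i, j) (i != j)%:R.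

Lemma swap_mx_unit (l : nat) : swap_mx l \is a GRing.unit.
Proof.
apply/unitrP; exists (swap_mx l); split;
  apply/matrixP=> i j; rewrite !mxE !big_ord_recl big_ord0 !mxE;
  by case: i => [[|[|i]] hi] //; case: j => [[|[|j]] hj] //;
     rewrite /= ?(mul0r, mul1r, add0r, addr0).
Qed.

(* the matrix [0 1; 1 0] *)
Definition gamma (l : nat) : {'GL_2(l)} := FinRing.unit _ (swap_mx_unit l).

(* the scalar matrix -I *)
Definition neg_one (l : nat) : {'GL_2(l)} := FinRing.unit _ (unitrN1 'M['F_l]_2).

Definition diag_cartan_plus (l : nat) : {set {'GL_2(l)}} :=
  (diag_cartan l :|: gamma l *: diag_cartan l)%g.

Lemma scalar_group_group_set (l : nat) : group_set (scalar_group l).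
Proof.
apply/group_setP; split=> [|x y]; rewrite !inE.
  by rewrite GL_1E; apply/is_scalar_mxP; exists 1.
move=> /is_scalar_mxP [a ha] /is_scalar_mxP [b hb].
by rewrite GL_MxE ha hb -scalar_mxM; apply/is_scalar_mxP; exists (a * b).
Qed.
Canonical scalar_group_group (l : nat) := Group (scalar_group_group_set l).

Lemma diag_cartan_group_set (l : nat) : group_set (diag_cartan l).
Proof.
apply/group_setP; split=> [|x y]; rewrite !inE.
  by rewrite GL_1E; apply: scalar_mx_is_diag.
move=> /diag_mxP [a ha] /diag_mxP [b hb].
by rewrite GL_MxE ha hb mulmx_diag; apply: diag_mx_is_diag.
Qed.
Canonical diag_cartan_group (l : nat) := Group (diag_cartan_group_set l).

Lemma SL2_group_set (l : nat) : group_set (SL2 l).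
Proof.
apply/group_setP; split=> [|x y]; rewrite !inE; first by rewrite GL_1E det1.
by move=> /eqP hx /eqP hy; rewrite GL_MxE det_mulmx hx hy mulr1.
Qed.
Canonical SL2_group (l : nat) := Group (SL2_group_set l).

Definition det_set (l : nat) (T : {set {'GL_2(l)}}) : {set 'F_l} :=
  [set \det (GLval g) | g in T].

Definition neg_det_set (l : nat) (T : {set {'GL_2(l)}}) : {set 'F_l} :=
  [set - \det (GLval g) | g in T].

Definition in_split_cartan_normalizer (l : nat) (G : {set {'GL_2(l)}}) : bool :=
  [exists x : {'GL_2(l)}, G \subset 'N(diag_cartan l :^ x)]%g.

(* 'D_m is the dihedral group of order m only for even m >= 4; 'D_4 is the
   Klein group. Cyclic groups (in particular of order 2) are not dihedral. *)
Definition dihedral (gT : finGroupType) (A : {set gT}) : bool :=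
  [&& 3 < #|A|, ~~ odd #|A| & (A \isog 'D_#|A|)%g]%N.

(* Since scalar matrices are central, coset_of (scalar_group l) is PGL_2. *)
Definition has_dihedral_image (l : nat) (G : {set {'GL_2(l)}}) : bool :=
  dihedral (G / scalar_group l)%g.

Definition tau (n : nat) : nat := size (divisors n).

Definition beta2 (n : nat) : nat :=
  let e := logn 2 n in if odd n then 1%N else (2 * (e ^ 2 - e) + 3)%N.

Definition beta (n : nat) : nat :=
  (beta2 n * \prod_(p <- primes n | p != 2) (logn p n).+1 ^ 2)%N.

Definition legendre (a : int) (p : nat) : int :=
  if a%:~R == 0 :> 'F_p then 0
  else if [exists x : 'F_p, x ^+ 2 == a%:~R] then 1 else -1.

Definition admissible (l : nat) (H : {set {'GL_2(l)}}) : bool :=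
  [&& H \subset diag_cartan l, ~~ (H \subset scalar_group l)
    & H <| diag_cartan_plus l]%g.

Definition twistable (l : nat) (H : {set {'GL_2(l)}}) : bool :=
  (det_set H == det_set (H :&: scalar_group l)) && (neg_one l \in H).

Definition scalar_index (l : nat) (H : {set {'GL_2(l)}}) : nat :=
  #|scalar_group l : H :&: scalar_group l|%g.

Definition G1 (l : nat) (H : {set {'GL_2(l)}}) : {group {'GL_2(l)}} :=
  <<H :|: [set gamma l]>>%G.

Definition G2 (l : nat) (delta : {'GL_2(l)}) (H : {set {'GL_2(l)}}) :
    {group {'GL_2(l)}} :=
  <<(H :|: [set gamma l * delta ^+ scalar_index H])%g>>%G.

(* Main.v *)
Require Import Defs.
From mathcomp Require Import all_boot all_order all_fingroup all_algebra all_solvable.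
From mathcomp Require Import ring.

Import GRing.Theory.
Local Open Scope group_scope.
Local Open Scope ring_scope.

Set Implicit Arguments.
Unset Strict Implicit.
Unset Printing Implicit Defensive.

(** Write C for the diagonal group, C+ for its normalizer, Z for the scalars and
U for the cyclic group F_l^* of even order l - 1, and identify a diagonal matrix
with its pair of entries.

Extensions. Let K be a subgroup of C+ that is not diagonal, and put
H = K :&: C.  An element g = gamma * diag(a, b) of K satisfies g^2 = ab and
conjugation by g swaps the two entries of a diagonal matrix.  So H is stable
under the swap, the scalar ab lies in S = H :&: Z, and K = <H, g>.  Conjugating
by diag(u, 1) replaces (a, b) by (au, b/u), so up to conjugacy K depends on H
and on the class of ab in S modulo det H only.  For h in H the scalar det h is
the product of h and its swap, hence S^2 <= det H <= S: there are at most two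
classes.  The trivial class gives G1; there is a second one exactly when
det H = S^2 <> S, that is when H is twistable, and it gives G2, because det
delta to the power [Z : S] generates S (lemma classification).  The image of K
in PGL_2 is generated by a cyclic group and an involution inverting it, so it is
dihedral if and only if H is not scalar (ext_dihedral, dihedral_ext).

Coincidences. The pairs (H, twist) therefore exhaust the classes.  If two of
the groups are conjugate by z and z maps H to H', then z is monomial, so
H = H', and the twist is read off from determinants.  If z does not map H to H',
then the square of every element of H' commutes with an antidiagonal element,
so it is scalar: both images in PGL_2 are Klein groups and every element of H
and H' has the form diag(a, a) or diag(a, -a).  Given S there are at most two
such nonscalar H, one containing diag(1, -1) and one not.  The matrix [1 1; 1 -1]
exchanges gamma and diag(1, -1), so for the second of them the group G1 H
is conjugate to an extension of the first one, and comparing determinants shows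
that there is no other coincidence (extension_conj_inj, redundant_conj).  Hence the
number of classes is the number of pairs minus the number of those redundant H
(card_classes, card_pairs).

Counting. Attach to a swap-stable H the subgroups S = {a : diag(a, a) in H} and
T = {a : diag(a, 1/a) in H} of U.  For diag(a, b) in H the product ab lies in S,
the quotient a/b in T, and one is a square there exactly when the other is.
Since S / S^2 and T / T^2 have order at most two, H is either the product of its
scalar and antiscalar parts or the full set cut out by these conditions.
The first kind corresponds to the pairs (S, T) that both contain -1 or both do not,
the second to the pairs that both contain -1 and are such that S and T consist of squares
of U either both or neither.  Twistable groups are those of the first
kind with -1 in S, and the redundant groups correspond to the S that contain -1 and
consist of squares of U.  Writing A, B, E, N for the numbers of subgroups of U
that do not contain -1, contain -1, contain -1 and consist of squares, contain
-1 and do not consist of squares, the number of classes is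
A^2 + B^2 + E^2 + N^2 - (A + B) + B^2 - B - E.  A subgroup of U is determined
by its order, which can be any divisor of l - 1, so A + B = tau (l - 1),
B = tau ((l - 1) / 2) and E = tau ((l - 1) / 4) or 0 according to whether 4
divides l - 1, that is whether -1 is a square; and the sum of the four squares
is beta (l - 1). *)

(** * Squares in a cyclic group *)

Section Squares.
Variable gT : finGroupType.
Implicit Types S T : {group gT}.

Definition squares (S : {set gT}) : {set gT} := [set (y ^+ 2)%g | y in S].

Lemma squaresP S x : reflect (exists2 y, y \in S & x = (y ^+ 2)%g) (x \in squares S).
Proof. exact: imsetP. Qed.

Lemma squares_sub S : squares S \subset S.
Proof. by apply/subsetP => _ /squaresP[y Sy ->]; rewrite groupX. Qed.

Lemma squares1 S : 1%g \in squares S.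
Proof. by apply/squaresP; exists 1%g; rewrite ?group1 ?expg1n. Qed.

Lemma squaresS S T : S \subset T -> squares S \subset squares T.
Proof. exact: imsetS. Qed.

Lemma squaresM S x y : abelian S ->
  x \in squares S -> y \in squares S -> (x * y)%g \in squares S.
Proof.
move=> /centsP cS /squaresP[u Su ->] /squaresP[v Sv ->].
apply/squaresP; exists (u * v)%g; first exact: groupM.
by rewrite expgMn //; apply: cS.
Qed.

Lemma squaresV S x : x \in squares S -> (x^-1)%g \in squares S.
Proof.
move=> /squaresP[u Su ->]; apply/squaresP; exists (u^-1)%g; first exact: groupVr.
by rewrite expgVn.
Qed.

(** The squares have index at most two in a cyclic group: they are the even powers of
a generator. *)
Lemma nonsquareM S x y : cyclic S -> x \in S -> y \in S ->
  x \notin squares S -> y \notin squares S -> (x * y)%g \in squares S.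
Proof.
move=> /cyclicP[w defS]; rewrite defS => /cycleP[i ->] /cycleP[j ->].
have sqE k : (w ^+ k)%g \notin squares <[w]> -> odd k.
  apply: contraNT => ek; apply/squaresP; exists (w ^+ k./2)%g; first exact: mem_cycle.
  by rewrite -expgM muln2 even_halfK.
move=> /sqE oi /sqE oj; rewrite -expgD; apply/squaresP.
exists (w ^+ (i + j)./2)%g; first exact: mem_cycle.
by rewrite -expgM muln2 even_halfK // oddD oi oj.
Qed.

(** If a generator is a square, every power of it is. *)
Lemma squares_gen S w : abelian S -> <[w]>%g = S -> w \in squares S -> squares S = S.
Proof.
move=> cS defS sqw; apply/eqP; rewrite eqEsubset squares_sub -{1}defS.
apply/subsetP => _ /cycleP[i ->]; elim: i => [|i IH]; first by rewrite expg0 squares1.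
by rewrite expgSr squaresM.
Qed.

End Squares.

(** * Subgroups of a cyclic group *)

Section SubgroupCount.
Variable gT : finGroupType.
Hypothesis cyc : cyclic [set: gT].

(** The order map is a bijection from the subgroups of a cyclic group to the divisors
of its order. *)
Lemma card_subgroups (P : pred nat) :
  #|[set S : {group gT} | P #|S|]| = count P (divisors #|gT|).
Proof.
pose f (S : {group gT}) := #|S|.
have injf : injective f.
  move=> S T eqST; apply/val_inj/eqP => /=.
  by rewrite (eq_subG_cyclic cyc) ?subsetT //; apply/eqP.
rewrite -size_filter cardE -(size_map f).
apply: perm_size; apply: uniq_perm.
- by rewrite map_inj_uniq ?enum_uniq.
- by rewrite filter_uniq ?divisors_uniq.
have gT0 : (0 < #|gT|)%N by rewrite -cardsT cardG_gt0.
move=> d; rewrite mem_filter -dvdn_divisors //; apply/mapP/andP.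
  case=> S; rewrite mem_enum inE => PS ->; split=> //.
  by rewrite -cardsT cardSg ?subsetT.
case=> Pd dvd; have [w defU] := cyclicP cyc.
have ow : #[w]%g = #|gT| by rewrite -cardsT defU.
have := cycle_sub_group; move=> /(_ _ w d); rewrite ow dvd => /(_ isT) E.
have : <[w ^+ (#|gT| %/ d)]>%G \in [set H : {group gT} | H \subset <[w]> & #|H| == d]%g.
  by rewrite E inE.
rewrite inE => /andP[_ /eqP cd]; exists <[w ^+ (#|gT| %/ d)]>%G => //.
by rewrite mem_enum inE /= cd.
Qed.

End SubgroupCount.

(** * The multiplicative group of F_l *)

(** Bundling the group once makes every product in it an instance of the same
structure, which keeps unification from unfolding the units of F_l; GL2 below serves
the same purpose for matrices. *)
Definition unitFp (l : nat) : finGroupType := {unit 'F_l}.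

Section Units.
Variable l : nat.
Hypotheses (l_prime : prime l) (l_odd : odd l).
Notation U := (unitFp l).

Lemma unitC (x y : U) : (x * y = y * x)%g.
Proof. by apply: val_inj; rewrite /= mulrC. Qed.

Lemma abelian_unit (S : {group U}) : abelian S.
Proof. by apply/centsP => x _ y _; apply: unitC. Qed.

Lemma cyclic_unit (S : {group U}) : cyclic S.
Proof. exact: field_unit_group_cyclic. Qed.

Lemma card_unitFp : #|{: U}| = l.-1.
Proof. by rewrite -cardsT card_finField_unit card_Fp. Qed.

Lemma unit_neq0 (x : U) : val x != 0.
Proof. by rewrite -unitfE; apply: valP. Qed.

Definition minus1 : U := FinRing.unit _ (unitrN1 'F_l).

Lemma Fp_neqN1 : (1 : 'F_l) != -1.
Proof.
apply/eqP => e; have : 2%:R == 0 :> 'F_l by rewrite -[2%:R]/(1 + 1 : 'F_l) {2}e subrr.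
rewrite -(dvdn_pcharf (pchar_Fp l_prime)) => d2.
have := dvdn_leq (isT : (0 < 2)%N) d2; by rewrite leqNgt odd_prime_gt2.
Qed.

Lemma minus1_neq1 : minus1 != 1%g.
Proof. by rewrite -val_eqE /= eq_sym Fp_neqN1. Qed.

Lemma minus1_sq : (minus1 ^+ 2 = 1)%g.
Proof. by apply: val_inj; rewrite /= mulrNN mulr1. Qed.

Lemma minus1M : (minus1 * minus1 = 1)%g.
Proof. exact: minus1_sq. Qed.

Lemma minus1V : (minus1^-1 = minus1)%g.
Proof. by apply: (mulgI minus1); rewrite mulgV minus1M. Qed.

Lemma minus1_neq (x : U) : (minus1 * x)%g != x.
Proof.
apply: contra (minus1_neq1) => /eqP e.
by rewrite -(mulgK x minus1) e mulgV.
Qed.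

Lemma unit_sq1 (x : U) : (x ^+ 2 = 1)%g -> x = 1%g \/ x = minus1.
Proof.
move=> /(congr1 val) /= => h; have /eqP : (val x - 1) * (val x + 1) = 0.
  by rewrite mulrDr mulr1 mulrDl mulN1r addrA subrK h subrr.
rewrite mulf_eq0 subr_eq0 addr_eq0 => /orP[] /eqP e; [left|right]; exact: val_inj.
Qed.

Lemma unit_sq_eq (x y : U) : (x ^+ 2 = y ^+ 2)%g -> x = y \/ x = (minus1 * y)%g.
Proof.
move=> h; have /unit_sq1[] : ((x * y^-1) ^+ 2 = 1)%g.
- rewrite expgMn; first by rewrite h expgVn mulgV.
  exact: unitC.
- by move=> e; left; rewrite -(mulgKV y x) e mul1g.
- by move=> e; right; rewrite -(mulgKV y x) e.
Qed.

(** Squaring identifies 1 and -1, so it is not surjective on a finite group that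
contains both. *)
Lemma nonsquare_exists (S : {group U}) : minus1 \in S -> exists2 y, y \in S & y \notin squares S.
Proof.
move=> Sm; apply/subsetPn; apply/negP => sS.
have /imset_injP inj : #|squares S| == #|S|.
  by rewrite eqn_leq leq_imset_card subset_leq_card.
have := inj 1%g minus1 (group1 S) Sm; rewrite expg1n minus1_sq => /(_ erefl) e.
by move: minus1_neq1; rewrite -e eqxx.
Qed.

(** Without -1, squaring is injective, hence surjective, on a finite subgroup. *)
Lemma nonsquare_minus1 (S : {group U}) y : y \in S -> y \notin squares S -> minus1 \in S.
Proof.
move=> Sy; apply: contraNT => Sm.
suff inj : {in S &, injective (fun x : U => x ^+ 2)%g}.
  have : squares S == S by rewrite eqEcard squares_sub (card_in_imset inj) leqnn.
  by move/eqP ->.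
move=> x z Sx Sz /unit_sq_eq[//|e]; case/negP: Sm.
by rewrite -(mulgK z minus1) -e groupM ?groupV.
Qed.

Lemma generator_nonsquare (S : {group U}) w :
  minus1 \in S -> <[w]>%g = S -> w \notin squares S.
Proof.
move=> /nonsquare_exists[y Sy nsy] defS.
by apply: contra nsy => sqw; rewrite (squares_gen (abelian_unit S) defS sqw).
Qed.

Lemma squaresMl (S : {group U}) x y : x \in S -> y \in S ->
  ((x * y)%g \in squares S) = ((x \in squares S) == (y \in squares S)).
Proof.
move=> Sx Sy; have [sx|nx] := boolP (x \in squares S);
  have [sy|ny] := boolP (y \in squares S); rewrite ?eqxx.
- by rewrite squaresM ?abelian_unit.
- apply: contraNF ny => sxy; rewrite -(mulKg x y).
  by rewrite (squaresM (abelian_unit S)) // squaresV.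
- apply: contraNF nx => sxy; rewrite -(mulgK y x).
  by rewrite (squaresM (abelian_unit S)) // squaresV.
- by rewrite (nonsquareM (cyclic_unit S)).
Qed.

(** Every element of S is a square of S or the quotient of one by u, so u decides for
all of S. *)
Lemma nonsquare_sub (S : {group U}) u : u \in S -> u \notin squares S ->
  (u \in squares [set: U]) = (S \subset squares [set: U]).
Proof.
move=> Su nu; apply/idP/subsetP => [squ x Sx|]; last by apply.
have [sx|nx] := boolP (x \in squares S).
  exact: (subsetP (squaresS (T := [set: U]%G) (subsetT S))).
rewrite -(mulgK u x) (squaresM (S := [set: U]%G)) ?abelian_unit ?squaresV //.
apply: (subsetP (squaresS (T := [set: U]%G) (subsetT S))).
exact: nonsquareM (cyclic_unit S) Sx Su nx nu.
Qed.

Lemma minus1_order : #[minus1]%g = 2%N.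
Proof. by apply: (nt_prime_order (isT : prime 2) minus1_sq minus1_neq1). Qed.

(** By Cauchy, since -1 is the only element of order two. *)
Lemma minus1_even (S : {group U}) : (minus1 \in S) = (2 %| #|S|)%N.
Proof.
apply/idP/idP => [Sm|]; first by rewrite -minus1_order order_dvdG.
move=> /(Cauchy (isT : prime 2))[x Sx ox].
have /unit_sq1[e|<- //] : (x ^+ 2 = 1)%g by rewrite -ox expg_order.
by move: ox; rewrite e order1.
Qed.

Lemma even_pred : (2 %| l.-1)%N.
Proof. by rewrite dvdn2 -subn1 oddB ?l_odd // prime_gt0. Qed.

(** U is cyclic, so S consists of squares exactly when S lies in the subgroup of index
two. *)
Lemma sub_squares (S : {group U}) :
  (S \subset squares [set: U]) = (2 * #|S| %| l.-1)%N.
Proof.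
have [w defS] := cyclicP (cyclic_unit S).
apply/idP/idP => [sS | dS].
  have /squaresP[y _ wy] : w \in squares [set: U].
    by apply: (subsetP sS); rewrite defS cycle_id.
  rewrite -(divnK even_pred) mulnC dvdn_pmul2r //.
  rewrite defS -orderE order_dvdn wy -expgM mulnC divnK ?even_pred //.
  by rewrite -card_unitFp -order_dvdn -cardsT order_dvdG ?inE.
have [v defU] := cyclicP (cyclic_unit [set: U]%G).
have ov : #[v]%g = l.-1 by rewrite orderE -defU cardsT card_unitFp.
set d := (l.-1 %/ #|S|)%N.
have dS' : (#|S| %| l.-1)%N by rewrite (dvdn_trans _ dS) // dvdn_mull.
have d2 : (2 %| d)%N by rewrite dvdn_divRL.
have -> : S :=: <[v ^+ d]>%g.
  apply/eqP; rewrite (eq_subG_cyclic (cyclic_unit [set: U]%G)) ?subsetT //.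
  rewrite -orderE orderXdiv ov ?dvdn_div // /d divnA // mulKn //.
  by rewrite -ov order_gt0.
apply/subsetP => _ /cycleP[i ->]; apply/squaresP.
exists (v ^+ (d %/ 2 * i))%g; first by rewrite inE.
by rewrite -!expgM mulnAC divnK.
Qed.

End Units.

Ltac ufield := apply: val_inj => /=; field; rewrite ?unit_neq0 //.

(** * Monomial matrices *)

Definition GL2 (l : nat) : finGroupType := {'GL_2(l)}.

Section Matrices.
Variable l : nat.
Notation U := (unitFp l).
Notation GL := (GL2 l).

Lemma det_mx2 (R : comNzRingType) (A : 'M[R]_2) :
  \det A = A 0 0 * A 1 1 - A 0 1 * A 1 0.
Proof.
rewrite (expand_det_row _ 0) !big_ord_recl big_ord0 addr0.
rewrite /cofactor !det_mx11 !mxE /= expr0 mul1r expr1 mulN1r mulrN.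
by congr (A _ _ * A _ _ - A _ _ * A _ _); apply: val_inj.
Qed.

Lemma mx2P (R : Type) (A B : 'M[R]_2) :
  A 0 0 = B 0 0 -> A 0 1 = B 0 1 -> A 1 0 = B 1 0 -> A 1 1 = B 1 1 -> A = B.
Proof.
move=> e00 e01 e10 e11; apply/matrixP => i j.
have c (k : 'I_2) : k = 0 \/ k = 1.
  by case: k => [[|[|k]] hk] //; [left|right]; apply: val_inj.
by case: (c i) => ->; case: (c j) => ->.
Qed.

Definition dgm (a b : 'F_l) : 'M['F_l]_2 :=
  \matrix_(i, j) (if i == j then if i == 0 then a else b else 0).

Lemma unit_det (A : 'M['F_l]_2) : (A \is a GRing.unit) = (\det A \is a GRing.unit).
Proof. exact: unitmxE. Qed.

Lemma dgm_unit (a b : U) : dgm (val a) (val b) \is a GRing.unit.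
Proof.
rewrite unit_det det_mx2 !mxE /= mulr0 subr0.
by rewrite unitrM !(valP a, valP b).
Qed.

Fact dg_key : unit. Proof. exact: tt. Qed.
(** The lock prevents unification from unfolding a diagonal matrix to its entries. *)
Definition dg (a b : U) : GL :=
  locked_with dg_key (FinRing.unit _ (dgm_unit a b)).

Lemma mulmx2E (R : comNzRingType) (A B : 'M[R]_2) i j :
  (A *m B) i j = A i 0 * B 0 j + A i 1 * B 1 j.
Proof. by rewrite mxE !big_ord_recl big_ord0 addr0; congr (A _ _ * B _ _ + A _ _ * B _ _); apply: val_inj. Qed.

Lemma dgE (a b : U) (i j : 'I_2) :
  (GLval (dg a b)) i j = if i == j then if i == 0 then val a else val b else 0.
Proof. by rewrite /dg unlock mxE. Qed.

(** The matrix gamma, seen in the bundled group. *)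
Definition gam : GL := gamma l.

Lemma gammaE (i j : 'I_2) : (GLval gam) i j = (i != j)%:R.
Proof. by rewrite mxE. Qed.

Lemma GL2P (x y : GL) :
  (GLval x) 0 0 = (GLval y) 0 0 -> (GLval x) 0 1 = (GLval y) 0 1 ->
  (GLval x) 1 0 = (GLval y) 1 0 -> (GLval x) 1 1 = (GLval y) 1 1 -> x = y.
Proof. by move=> *; apply: val_inj; apply: mx2P. Qed.

Lemma GL2M (x y : GL) i j : (GLval (x * y)%g) i j =
  (GLval x) i 0 * (GLval y) 0 j + (GLval x) i 1 * (GLval y) 1 j.
Proof. exact: mulmx2E. Qed.

Lemma det_GLM (x y : GL) : \det (GLval (x * y)%g) = \det (GLval x) * \det (GLval y).
Proof. exact: det_mulmx. Qed.

Ltac mx2 := apply: GL2P; rewrite ?(GL2M, dgE, gammaE) /=; ring.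

Lemma dgM a b c d : (dg a b * dg c d = dg (a * c) (b * d))%g.
Proof. mx2. Qed.

Lemma dg1 : dg 1%g 1%g = 1%g.
Proof. by apply: GL2P; rewrite ?dgE /= /GLval /= !mxE. Qed.

Lemma dgV a b : ((dg a b)^-1 = dg a^-1 b^-1)%g.
Proof. by apply: (mulgI (dg a b)); rewrite mulgV dgM !mulgV dg1. Qed.

Lemma dgX a b n : (dg a b ^+ n = dg (a ^+ n) (b ^+ n))%g.
Proof. by elim: n => [|n IH]; rewrite ?expg0 ?dg1 // !expgS IH dgM. Qed.

Lemma dg_inj a b c d : dg a b = dg c d -> a = c /\ b = d.
Proof.
move=> e; split; apply: val_inj.
  by move: (congr1 (fun x : GL => (GLval x) 0 0) e); rewrite !dgE.
by move: (congr1 (fun x : GL => (GLval x) 1 1) e); rewrite !dgE.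
Qed.

Lemma dg_neg_one : neg_one l = dg (minus1 l) (minus1 l).
Proof. by apply: GL2P; rewrite dgE !mxE //= ?oppr0. Qed.

Lemma dgC a b c d : commute (dg a b) (dg c d).
Proof. by rewrite /commute !dgM (unitC a) (unitC b). Qed.

Lemma gamma_sq : (gam * gam = 1)%g.
Proof.
apply: GL2P; rewrite !GL2M !gammaE /= /GLval /= !mxE /=; ring.
Qed.

Lemma gammaV : ((gam)^-1 = gam)%g.
Proof. by apply: (mulgI (gam)); rewrite mulgV gamma_sq. Qed.

Lemma dg_gamma a b : (dg a b * gam = gam * dg b a)%g.
Proof. mx2. Qed.

Lemma dg_conj_gamma a b : (dg a b ^ gam = dg b a)%g.
Proof. by rewrite conjgE gammaV dg_gamma mulgA gamma_sq mul1g. Qed.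

Lemma det_dg a b : \det (GLval (dg a b)) = val (a * b)%g.
Proof. by rewrite det_mx2 !dgE /= mulr0 subr0. Qed.

Lemma det_gamma : \det (GLval gam) = -1.
Proof. by rewrite det_mx2 !gammaE /=; ring. Qed.

Lemma diagP g : reflect (exists a b, g = dg a b) (g \in diag_cartan l).
Proof.
rewrite inE; apply: (iffP idP) => [/is_diag_mxP dg0 | [a [b ->]]]; last first.
  apply/is_diag_mxP => i j ij; rewrite dgE.
  by rewrite ifN.
have g01 : (GLval g) 0 1 = 0 by apply: dg0.
have g10 : (GLval g) 1 0 = 0 by apply: dg0.
have := GL_unit g; rewrite unit_det det_mx2 g01 mul0r subr0.
rewrite unitrM => /andP[u0 u1].
exists (FinRing.unit _ u0), (FinRing.unit _ u1).
by apply: GL2P; rewrite dgE.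
Qed.

Lemma dg_diag a b : dg a b \in diag_cartan l.
Proof. by apply/diagP; exists a, b. Qed.

Lemma scalP g : reflect (exists a, g = dg a a) (g \in scalar_group l).
Proof.
rewrite inE; apply: (iffP idP) => [/is_scalar_mxP[c gE] | [a ->]]; last first.
  apply/is_scalar_mxP; exists (val a); apply: mx2P; rewrite dgE !mxE //=.
have := GL_unit g; rewrite unit_det gE det_scalar expr2.
rewrite unitrM => /andP[u0 _].
by exists (FinRing.unit _ u0); apply: GL2P; rewrite dgE gE !mxE.
Qed.

Lemma dg_scal a b : (dg a b \in scalar_group l) = (a == b).
Proof.
apply/scalP/eqP => [[c /dg_inj[-> ->]] // | ->]; by exists b.
Qed.

Lemma scal_diag : scalar_group l \subset diag_cartan l.
Proof. by apply/subsetP => g /scalP[a ->]; apply: dg_diag. Qed.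

Lemma cartan_plusP g :
  reflect (g \in diag_cartan l \/ exists a b, g = (gam * dg a b)%g)
          (g \in diag_cartan_plus l).
Proof.
rewrite /diag_cartan_plus in_setU mem_lcoset; apply: (iffP orP) => [[->|] | [->|[a [b ->]]]].
- by left.
- by move=> /diagP[a [b e]]; right; exists a, b; rewrite -e mulKVg.
- by left.
- by right; rewrite mulKg dg_diag.
Qed.

Lemma antidiag_notin a b : (gam * dg a b)%g \notin diag_cartan l.
Proof.
apply/negP => /diagP[c [d e]].
move: (congr1 (fun x : GL => (GLval x) 0 1) e).
rewrite GL2M !gammaE !dgE /= mul0r add0r mul1r => /eqP; apply/negP.
exact: unit_neq0.
Qed.

Lemma antidiagM a b c d :
  (gam * dg a b * (gam * dg c d) = dg (b * c) (a * d))%g.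
Proof. by rewrite mulgA -(mulgA (gam)) dg_gamma mulgA gamma_sq mul1g dgM. Qed.

Lemma conj_antidiag a b c d : (dg c d ^ (gam * dg a b) = dg d c)%g.
Proof.
by rewrite conjgM dg_conj_gamma conjgE dgC mulKg.
Qed.

(** Conjugation by diag(u, 1) moves the two entries in opposite directions, so only
their product is an invariant. *)
Lemma antidiag_conj a b u :
  ((gam * dg a b) ^ dg u 1 = gam * dg (a * u) (b * u^-1))%g.
Proof.
rewrite conjgE dgV invg1 !mulgA dg_gamma -!mulgA !dgM !mul1g mulg1.
by rewrite (unitC b).
Qed.

Lemma diag_abelian : abelian (diag_cartan l).
Proof. by apply/centsP => _ /diagP[a [b ->]] _ /diagP[c [d ->]]; apply: dgC. Qed.

Lemma gamma_plus : gam \in diag_cartan_plus l.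
Proof. by apply/cartan_plusP; right; exists 1%g, 1%g; rewrite dg1 mulg1. Qed.

Lemma cartan_plus_group_set : group_set (diag_cartan_plus l).
Proof.
apply/group_setP; split; first by apply/cartan_plusP; left; rewrite group1.
move=> x y /cartan_plusP[/diagP[a [b ->]]|[a [b ->]]] /cartan_plusP[/diagP[c [d ->]]|[c [d ->]]];
  apply/cartan_plusP.
- by left; rewrite dgM dg_diag.
- by right; exists (b * c)%g, (a * d)%g; rewrite mulgA dg_gamma -mulgA dgM.
- by right; exists (a * c)%g, (b * d)%g; rewrite -mulgA dgM.
- by left; rewrite antidiagM dg_diag.
Qed.
Canonical cartan_plus_group := Group cartan_plus_group_set.

Lemma diag_plus : diag_cartan l \subset diag_cartan_plus l.
Proof. by apply/subsetP => g Dg; apply/cartan_plusP; left. Qed.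

Lemma cartan_plus_norm : diag_cartan_plus l \subset 'N(diag_cartan l)%g.
Proof.
apply/subsetP => g /cartan_plusP[Dg|[a [b ->]]].
  by apply: (subsetP (normG _)).
apply/normP/eqP; rewrite eqEcard cardJg leqnn andbT.
by apply/subsetP => _ /imsetP[_ /diagP[c [d ->]] ->]; rewrite conj_antidiag dg_diag.
Qed.

Lemma GL_col0 (g : GL) : (GLval g) 0 0 = 0 -> (GLval g) 0 1 != 0 /\ (GLval g) 1 0 != 0.
Proof.
move=> g00; have := GL_unit g.
rewrite unit_det det_mx2 g00 mul0r sub0r unitrN unitrM.
by rewrite !unitfE => /andP.
Qed.

(** The conjugate is diagonal with the same distinct eigenvalues, so x permutes the
two eigenlines, which are the coordinate axes. *)
Lemma diag_conj_plus a b x : a != b -> (dg a b ^ x)%g \in diag_cartan l ->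
  x \in diag_cartan_plus l.
Proof.
move=> neq /diagP[c [d e]].
have {e} E : (dg a b * x = x * dg c d)%g by rewrite conjgC e.
have e i j := congr1 (fun x : GL => (GLval x) i j) E.
move: (e 0 0) (e 0 1) (e 1 0) (e 1 1); rewrite !GL2M !dgE /=.
rewrite !mul0r !mulr0 !addr0 !add0r => e00 e01 e10 e11.
have nab : val a - val b != 0 by rewrite subr_eq0; apply: contra neq => /eqP/val_inj->.
apply/cartan_plusP.
have [x00|nz] := eqVneq ((GLval x) 0 0) 0.
  have [n01 n10] := GL_col0 x00; right.
  have x11 : (GLval x) 1 1 = 0.
    have ad : val a = val d by apply: (mulIf n01); rewrite e01 mulrC.
    apply/eqP; move/eqP: e11; rewrite -ad mulrC -subr_eq0 -mulrBr mulf_eq0.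
    by rewrite -[_ - _ == 0]oppr_eq0 opprB (negPf nab) orbF.
  have u0 : (GLval x) 0 1 \is a GRing.unit by rewrite unitfE.
  have u1 : (GLval x) 1 0 \is a GRing.unit by rewrite unitfE.
  exists (FinRing.unit _ u1), (FinRing.unit _ u0).
  by apply: GL2P; rewrite ?(GL2M, dgE, gammaE) /= ?(mul0r,mul1r,addr0,add0r,mulr0).
left; have ac : val a = val c by apply: (mulIf nz); rewrite e00 mulrC.
have x10 : (GLval x) 1 0 = 0.
  apply/eqP; move/eqP: e10; rewrite -ac mulrC -subr_eq0 -mulrBr mulf_eq0.
  by rewrite -[_ - _ == 0]oppr_eq0 opprB (negPf nab) orbF.
have := GL_unit x; rewrite unit_det det_mx2 x10 mulr0 subr0.
rewrite unitrM !unitfE => /andP[_ n11].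
have bd : val b = val d by apply: (mulIf n11); rewrite e11 mulrC.
have x01 : (GLval x) 0 1 = 0.
  apply/eqP; move/eqP: e01; rewrite -bd mulrC -subr_eq0 -mulrBr mulf_eq0.
  by rewrite (negPf nab) orbF.
have u0 : (GLval x) 0 0 \is a GRing.unit by rewrite unitfE.
have u1 : (GLval x) 1 1 \is a GRing.unit by rewrite unitfE.
apply/diagP; exists (FinRing.unit _ u0), (FinRing.unit _ u1).
by apply: GL2P; rewrite dgE.
Qed.

End Matrices.

(** * Swap-stable diagonal groups *)

(** The union of H and its coset is already closed under products. *)
Lemma gen_coset (gT : finGroupType) (H : {group gT}) (g : gT) :
  (g * g)%g \in H -> (forall h, h \in H -> (h ^ g)%g \in H) ->
  <<H :|: [set g]>>%g = (H :|: g *: H)%g.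
Proof.
move=> gg nH; have grp : group_set (H :|: g *: H)%g.
  apply/group_setP; split; first by rewrite inE group1.
  move=> u v; rewrite !in_setU !mem_lcoset.
  have [Hu _|nu /= gu] := boolP (u \in H).
    case/orP => [Hv|gv]; first by rewrite groupM.
    apply/orP; right.
    have -> : (g^-1 * (u * v) = u ^ g * (g^-1 * v))%g.
      by rewrite conjgE !mulgA mulgK.
    by rewrite groupM ?nH.
  case/orP => [Hv|gv]; first by rewrite mulgA [X in _ || X]groupM ?orbT.
  have -> : (u * v = g * g * ((g^-1 * u) ^ g * (g^-1 * v)))%g.
    by rewrite conjgE !mulgA !mulgK mulgV mul1g.
  by rewrite groupM // groupM ?nH.
apply/eqP; rewrite eqEsubset; apply/andP; split.
  by rewrite (gen_subG _ (Group grp)) setUS // sub1set mem_lcoset mulVg group1.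
rewrite subUset sub_gen ?subsetUl //=; apply/subsetP => u.
rewrite mem_lcoset => gu; rewrite -(mulKVg g u) groupM //.
  by rewrite mem_gen // !inE eqxx orbT.
by rewrite mem_gen // inE gu.
Qed.

Section Subgroups.
Variable l : nat.
Hypotheses (l_prime : prime l) (l_odd : odd l).
Notation U := (unitFp l).
Notation GL := (GL2 l).
Notation gam := (gam l).
Implicit Types (H G K : {group GL}) (g h : GL) (a b c d x y : U).

(** For a diagonal group, this is normality in C+, since C is abelian. *)
Definition swap_stable (H : {set GL}) : bool :=
  (H \subset diag_cartan l) && (gam \in 'N(H))%g.

Definition scal_part (H : {set GL}) : {set U} := [set a | dg a a \in H].
(** The intersection of H with SL_2, read in F_l^*. *)
Definition anti_part (H : {set GL}) : {set U} := [set a | dg a (a^-1)%g \in H].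

Lemma scal_part_group_set H : group_set (scal_part H).
Proof.
apply/group_setP; split=> [|x y]; rewrite !inE ?dg1 //.
by move=> Hx Hy; rewrite -dgM groupM.
Qed.
Canonical scal_part_group H := Group (scal_part_group_set H).

Lemma anti_part_group_set H : group_set (anti_part H).
Proof.
apply/group_setP; split=> [|x y]; rewrite !inE ?invg1 ?dg1 //.
by move=> Hx Hy; rewrite invMg (unitC y^-1) -dgM groupM.
Qed.
Canonical anti_part_group H := Group (anti_part_group_set H).

Lemma swap_stableE H a b : swap_stable H -> dg a b \in H -> dg b a \in H.
Proof. by move=> /andP[_ nH] Hab; rewrite -dg_conj_gamma memJ_norm. Qed.

Lemma swap_stableP H :
  reflect (H \subset diag_cartan l /\ forall a b, dg a b \in H -> dg b a \in H)
          (swap_stable H).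
Proof.
apply: (iffP idP) => [sH | [sD sw]].
  by split; [case/andP: sH | move=> a b; apply: swap_stableE].
apply/andP; split=> //; apply/normP/eqP; rewrite eqEcard cardJg leqnn andbT.
apply/subsetP => _ /imsetP[h Hh ->].
have /diagP[a [b e]] := subsetP sD h Hh.
by rewrite e dg_conj_gamma sw // -e.
Qed.

Lemma admissibleE H : admissible H = swap_stable H && ~~ (H \subset scalar_group l).
Proof.
rewrite /admissible /swap_stable -!andbA; case sD: (H \subset _) => //=.
rewrite andbC; congr (_ && _); apply/idP/idP => [/andP[_ nH]|nH].
  by apply: (subsetP nH); apply: gamma_plus.
apply/andP; split; first exact: subset_trans sD (diag_plus l).
have Hd : diag_cartan l \subset 'N(H)%g.
  by apply: cents_norm; apply: (sub_abelian_cent (diag_abelian l)).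
apply/subsetP => g /cartan_plusP[/(subsetP Hd)//|[a [b ->]]].
by rewrite groupM // (subsetP Hd) ?dg_diag.
Qed.

Lemma nonscalarP H : H \subset diag_cartan l ->
  reflect (exists a b, a != b /\ dg a b \in H) (~~ (H \subset scalar_group l)).
Proof.
move=> sD; apply: (iffP subsetPn) => [[h Hh]|[a [b [ab Hab]]]].
  have /diagP[a [b e]] := subsetP sD h Hh.
  by rewrite e dg_scal => ab; exists a, b; rewrite -e.
by exists (dg a b); rewrite ?dg_scal.
Qed.

Section Symmetric.
Variable H : {group GL}.
Hypothesis symH : swap_stable H.
Let S := scal_part_group H.
Let T := anti_part_group H.

Lemma sub_diag : H \subset diag_cartan l.
Proof. by case/andP: symH. Qed.

(** The product of diag(a, b) and its swap diag(b, a) is the scalar ab. *)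
Lemma scal_part_mul a b : dg a b \in H -> (a * b)%g \in S.
Proof.
by move=> Hab; rewrite inE {2}(unitC a) -dgM groupM // swap_stableE.
Qed.

(** The quotient of diag(a, b) by its swap is diag(a/b, b/a). *)
Lemma anti_part_div a b : dg a b \in H -> (a * b^-1)%g \in T.
Proof.
move=> Hab; rewrite inE invMg invgK -dgM groupM //.
by rewrite -dgV groupV swap_stableE.
Qed.

Lemma mem_scal_anti x y : x \in S -> y \in T -> dg (x * y) (x * y^-1)%g \in H.
Proof. by rewrite !inE => Hx Hy; rewrite -dgM groupM. Qed.

(** Dividing diag(a, b) by the scalar x leaves a matrix of determinant one. *)
Lemma split_scal a b x : dg a b \in H -> x \in S -> (a * b = x ^+ 2)%g ->
  (a * x^-1)%g \in T /\ (b = x * (a * x^-1)^-1)%g.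
Proof.
rewrite !inE => Hab Hx e.
have be : (b = x * (a * x^-1)^-1)%g.
  by rewrite invMg invgK mulgA -[(x * x)%g]/(x ^+ 2)%g -e (unitC a) mulgK.
split=> //; have -> : ((a * x^-1)^-1 = b * x^-1)%g by rewrite be (unitC x) mulgK.
by rewrite -dgM -(dgV x x) groupM ?groupV.
Qed.

Lemma split_anti a b y : dg a b \in H -> y \in T -> (a * b^-1 = y ^+ 2)%g ->
  (a * y^-1)%g \in S /\ (b = a * y^-1 * y^-1)%g.
Proof.
rewrite !inE => Hab Hy e.
have be : (b = a * y^-1 * y^-1)%g.
  by rewrite -mulgA -invMg -[(y * y)%g]/(y ^+ 2)%g -e invMg invgK (unitC b) mulKVg.
split=> //; have E : (a * y^-1 = b * y)%g by rewrite be mulgKV.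
by rewrite {2}E -dgM groupM // -[in X in dg _ X](invgK y) -dgV groupV.
Qed.

(** Either condition says that diag(a, b) is the product of a scalar of H and an
element of H of determinant one. *)
Lemma squares_scal_anti a b : dg a b \in H ->
  ((a * b)%g \in squares S) = ((a * b^-1)%g \in squares T).
Proof.
move=> Hab; apply/squaresP/squaresP => [[x Sx e]|[y Ty e]].
  have [Ty be] := split_scal Hab Sx e; exists (a * x^-1)%g => //.
  by rewrite be; ufield.
have [Sx be] := split_anti Hab Ty e; exists (a * y^-1)%g => //.
by rewrite be; ufield.
Qed.

Lemma minus1_scal_anti : (minus1 l \in S) = (minus1 l \in T).
Proof.
by rewrite !inE minus1V.
Qed.

(** The scalar x has determinant x^2, so the determinants of the scalars of H are the
squares of its scalar part. *)
Lemma det_set_squaresP :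
  reflect (forall a b, dg a b \in H -> (a * b)%g \in squares S)
          (det_set H == det_set (H :&: scalar_group l)%g).
Proof.
apply: (iffP eqP) => [e a b Hab | sq].
  have : \det (GLval (dg a b)) \in det_set H by apply/imsetP; exists (dg a b).
  rewrite e => /imsetP[h /setIP[Hx /scalP[x xE]] ]; subst.
  rewrite !det_dg => /val_inj ->; apply/squaresP; exists x; by rewrite ?inE.
apply/eqP; rewrite eqEsubset; apply/andP; split; last first.
  by apply: imsetS; apply: subsetIl.
apply/subsetP => _ /imsetP[h Hh ->].
have /diagP[a [b e]] := subsetP sub_diag h Hh.
rewrite e in Hh *; have /squaresP[x Sx ex] := sq _ _ Hh.
apply/imsetP; exists (dg x x); last by rewrite !det_dg ex.
by rewrite in_setI dg_scal eqxx andbT; rewrite inE in Sx.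
Qed.

End Symmetric.

Lemma cartan_notdiag g : g \in diag_cartan_plus l -> g \notin diag_cartan l ->
  exists a b, g = (gam * dg a b)%g.
Proof. by move=> /cartan_plusP[-> //|]. Qed.

Lemma notdiagM g h : g \in diag_cartan_plus l -> h \in diag_cartan_plus l ->
  g \notin diag_cartan l -> h \notin diag_cartan l -> (g * h)%g \in diag_cartan l.
Proof.
move=> Pg Ph /(cartan_notdiag Pg)[a [b ->]] /(cartan_notdiag Ph)[c [d ->]].
by rewrite antidiagM dg_diag.
Qed.

(** C has index two in C+. *)
Lemma notdiag_div K g h : K \subset diag_cartan_plus l -> g \in K -> h \in K ->
  g \notin diag_cartan l -> h \notin diag_cartan l ->
  (g^-1 * h)%g \in K :&: diag_cartan l.
Proof.
move=> sP Kg Kh ng nh; rewrite inE groupM ?groupV //=.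
by apply: notdiagM; rewrite ?groupV //; apply: (subsetP sP).
Qed.

Lemma antidiag_ext_sub K1 K2 g : K1 \subset diag_cartan_plus l ->
  g \in K1 -> g \in K2 -> g \notin diag_cartan l ->
  K1 :&: diag_cartan l \subset K2 -> K1 \subset K2.
Proof.
move=> s1 g1 g2 ng e; apply/subsetP => x Kx.
have [Dx|nx] := boolP (x \in diag_cartan l).
  by apply: (subsetP e); rewrite inE Kx.
by rewrite -(mulKVg g x) groupM // (subsetP e) // notdiag_div.
Qed.

(** With g = gamma * diag(a, b), the square of g is the scalar ab, so the union of H
and g * H is a group. *)
Lemma antidiag_ext H a b (g := (gam * dg a b)%g) : swap_stable H ->
  dg (a * b)%g (a * b)%g \in H ->
  [/\ <<H :|: [set g]>>%G \subset diag_cartan_plus l,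
      (<<H :|: [set g]>>%G :&: diag_cartan l)%g = H
    & g \in <<H :|: [set g]>>%G].
Proof.
move=> symH Hab; have sD := sub_diag symH.
have nH h : h \in H -> (h ^ g)%g \in H.
  move=> Hh; have /diagP[c [d e]] := subsetP sD h Hh.
  by rewrite e conj_antidiag swap_stableE // -e.
have gg : (g * g)%g \in H by rewrite antidiagM (unitC b).
have gP : g \in diag_cartan_plus l by apply/cartan_plusP; right; exists a, b.
have gE := gen_coset gg nH.
split.
- rewrite gen_subG subUset sub1set gP andbT.
  exact: subset_trans sD (diag_plus l).
- apply/setP => u; rewrite /= gE in_setI in_setU mem_lcoset.
  apply/andP/idP => [[/orP[//|gu] Du]|Hu]; last by rewrite Hu (subsetP sD).
  case/negP: (antidiag_notin a b); rewrite -/g.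
  have -> : g = (u * (g^-1 * u)^-1)%g by rewrite invMg invgK mulgA mulgV mul1g.
  by rewrite groupM // groupV (subsetP sD).
- by rewrite mem_gen // !inE eqxx orbT.
Qed.

End Subgroups.

(** * Extensions by an antidiagonal element *)

Section Extensions.
Variable l : nat.
Hypotheses (l_prime : prime l) (l_odd : odd l).
Notation U := (unitFp l).
Notation GL := (GL2 l).
Notation gam := (gam l).
Implicit Types (H G K L : {group GL}) (g h : GL) (a b c d x y : U).

Lemma card_scalar : #|scalar_group l| = #|{: U}|.
Proof.
have inj : injective (fun a : U => dg a a) by move=> a b /dg_inj[].
rewrite -(card_imset predT inj); apply: eq_card => g.
by apply/scalP/imsetP => [[a ->]|[a _ ->]]; exists a.
Qed.

(** The map a |-> diag(a, a) identifies F_l^* with Z, and the scalar part of H with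
the scalars in H. *)
Lemma scalar_indexE H : (#|scal_part H| * scalar_index H)%N = l.-1.
Proof.
rewrite -card_unitFp // -card_scalar /scalar_index.
rewrite -(Lagrange (subsetIr H (scalar_group l))); congr (_ * _)%N.
have inj : injective (fun a : U => dg a a) by move=> a b /dg_inj[].
rewrite -(card_imset _ inj); apply: eq_card => g.
rewrite in_setI; apply/imsetP/andP => [[a Sa ->]|[Hg /scalP[a e]]].
  by rewrite dg_scal eqxx; move: Sa; rewrite inE.
by exists a => //; rewrite inE -e.
Qed.

Lemma diag_conj_dg H a b : H \subset diag_cartan l -> H :^ dg a b = H.
Proof.
move=> sD; apply/normP; apply: (subsetP _ _ (dg_diag a b)).
by apply: cents_norm; apply: (sub_abelian_cent (diag_abelian l)).
Qed.

Lemma diag_plus_conj a b : (diag_cartan_plus l :^ dg a b)%g = diag_cartan_plus l.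
Proof. by apply: (conjGid (G := cartan_plus_group l)); apply: (subsetP (diag_plus l)); apply: dg_diag. Qed.

(** The matrix diag(c/a, 1) carries the antidiagonal element of K to that of L and
centralizes their common diagonal part. *)
Lemma antidiag_ext_conj K L a b c d : K \subset diag_cartan_plus l -> L \subset diag_cartan_plus l ->
  (K :&: diag_cartan l = L :&: diag_cartan l)%g ->
  (gam * dg a b)%g \in K -> (gam * dg c d)%g \in L -> (a * b = c * d)%g ->
  (K :^ dg (a^-1 * c) 1)%g = L.
Proof.
move=> sK sL e Kg Lg abcd; set u := (a^-1 * c)%g.
have E : ((gam * dg a b) ^ dg u 1 = gam * dg c d)%g.
  have be : (b = a^-1 * (c * d))%g by rewrite -abcd mulKg.
  rewrite antidiag_conj; congr (gam * dg _ _)%g; first by rewrite /u mulKVg.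
  by rewrite be /u; ufield.
have sKu : (K :^ dg u 1)%g \subset diag_cartan_plus l.
  by rewrite -(diag_plus_conj u 1) conjSg.
have gKu : (gam * dg c d)%g \in (K :^ dg u 1)%g by rewrite -E memJ_conjg.
have eu : ((K :^ dg u 1) :&: diag_cartan l = L :&: diag_cartan l)%g.
  rewrite -{1}(diag_conj_dg u 1 (subxx (diag_cartan l))) -conjIg e.
  exact: (@diag_conj_dg (L :&: diag_cartan l) u 1 (subsetIr _ _)).
apply/eqP; rewrite eqEsubset; apply/andP; split.
  apply: (antidiag_ext_sub (K1 := (K :^ dg u 1)%G) sKu gKu Lg (antidiag_notin c d)).
  by rewrite /= eu subsetIl.
apply: (antidiag_ext_sub (K2 := (K :^ dg u 1)%G) sL Lg gKu (antidiag_notin c d)).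
by rewrite /= -eu subsetIl.
Qed.

Lemma G1_ext H : swap_stable H ->
  [/\ G1 H \subset diag_cartan_plus l, (G1 H :&: diag_cartan l)%g = H & gam \in G1 H].
Proof.
move=> symH; have := @antidiag_ext l H 1%g 1%g symH; rewrite mulg1 !dg1 mulg1.
by apply; apply: group1.
Qed.

Lemma det_antidiag a b : \det (GLval (gam * dg a b)%g) = - val (a * b)%g.
Proof. by rewrite det_GLM det_gamma det_dg mulN1r. Qed.

(** In G1 H, multiplication by gamma exchanges H and its complement and changes the
sign of the determinant. *)
Lemma det_G1 H : swap_stable H -> det_set H = neg_det_set (G1 H :\: H).
Proof.
move=> symH; have [sP eH gG] := G1_ext symH; have sD := sub_diag symH.
have ng : gam \notin diag_cartan l by have := @antidiag_notin l 1 1; rewrite dg1 mulg1.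
apply/setP => x; apply/imsetP/imsetP => [[h Hh ->]|[g]].
  exists (gam * h)%g; last by rewrite det_GLM det_gamma mulN1r opprK.
  have Gh : h \in G1 H by move: Hh; rewrite -{1}eH => /setIP[].
  rewrite in_setD; apply/andP; split; last exact: groupM.
  apply: contra ng => /(subsetP sD).
  by rewrite groupMr // (subsetP sD).
rewrite in_setD => /andP[nHg Gg] ->.
have ngd : g \notin diag_cartan l by apply: contra nHg; rewrite -{1}eH in_setI Gg.
have := notdiag_div sP gG Gg ng ngd; rewrite eH => Hh.
exists (gam^-1 * g)%g => //.
by rewrite -{1}(mulKVg gam g) det_GLM det_gamma mulN1r opprK.
Qed.

Section Delta.
Variables d1 d2 : U.
Hypothesis gen : <[d1 * d2]>%g = [set: U].
Notation delta := (dg d1 d2).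

(** The determinant of delta to the power [Z : H :&: Z]; up to sign, that of the
generator of G2 H. *)
Definition twist H : U := ((d1 * d2) ^+ scalar_index H)%g.

(** A generator of F_l^* to the power of the index of a subgroup generates that
subgroup. *)
Lemma twist_gen H : <[twist H]>%g = scal_part H.
Proof.
apply/eqP; rewrite (eq_subG_cyclic (cyclic_unit [set: U]%G)) ?subsetT //.
have ow : #[(d1 * d2)%g]%g = l.-1 by rewrite orderE gen cardsT card_unitFp.
have e := scalar_indexE H.
rewrite -orderE orderXdiv ow -{1}e ?dvdn_mull // mulnK //.
by rewrite lt0n; apply/eqP => i0; move: e; rewrite i0 muln0 => e; move: (order_gt0 (d1 * d2)%g); rewrite ow -e.
Qed.

Lemma twistE H : (d1 ^+ scalar_index H * d2 ^+ scalar_index H)%g = twist H.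
Proof. by rewrite /twist expgMn //; apply: unitC. Qed.

Lemma twist_mem H : twist H \in scal_part H.
Proof. by rewrite -twist_gen cycle_id. Qed.

Lemma G2_ext H : swap_stable H ->
  [/\ G2 delta H \subset diag_cartan_plus l, (G2 delta H :&: diag_cartan l)%g = H
    & (gam * dg (d1 ^+ scalar_index H) (d2 ^+ scalar_index H))%g \in G2 delta H].
Proof.
move=> symH; have -> : G2 delta H = <<H :|: [set (gam * delta ^+ scalar_index H)%g]>>%G.
  by [].
rewrite dgX; apply: antidiag_ext => //.
by rewrite twistE; have := twist_mem H; rewrite inE.
Qed.

Lemma twist_nonsquare H : twistable H -> twist H \notin squares (scal_part H).
Proof.
move=> /andP[_ Hm]; apply: generator_nonsquare (twist_gen H) => //.
by rewrite inE -dg_neg_one.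
Qed.

(** A common value would make the twist a square of the scalar part of H, which it
generates. *)
Lemma det_G2 H : swap_stable H -> twistable H ->
  [disjoint det_set H & neg_det_set (G2 delta H :\: H)].
Proof.
move=> symH tw; have [sP eH gG] := G2_ext symH; have sD := sub_diag symH.
set g0 := (gam * _)%g in gG; have ng : g0 \notin diag_cartan l by apply: antidiag_notin.
have sq := det_set_squaresP symH (proj1 (andP tw)).
have := twist_nonsquare tw; apply: contraR => /pred0Pn[x /andP[/imsetP[h Hh xh]]].
have [a [b he]] := diagP _ (subsetP sD h Hh); rewrite {}he in Hh xh.
move=> /imsetP[g]; rewrite in_setD => /andP[nHg Gg].
have ngd : g \notin diag_cartan l by apply: contra nHg; rewrite -{1}eH in_setI Gg.
have := notdiag_div sP gG Gg ng ngd; rewrite eH => Hk.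
have [c [d ke]] := diagP _ (subsetP sD _ Hk); rewrite ke in Hk.
rewrite -(mulKVg g0 g) ke xh /g0 -mulgA dgM det_antidiag opprK det_dg.
move=> /val_inj abe.
have -> : twist H = (a * b * (c * d)^-1)%g by rewrite abe -twistE; ufield.
by rewrite squaresM ?squaresV ?abelian_unit ?sq.
Qed.

(** The square of gamma * diag(a, b) is the scalar ab. Only its class modulo det H
matters: if det H meets that class, the element can be corrected to have the invariant
of gamma; otherwise ab is a nonsquare of the scalar part, as is the twist, and they
differ by a square. *)
Lemma classification K : K \subset diag_cartan_plus l -> ~~ (K \subset diag_cartan l) ->
  let H := (K :&: diag_cartan l)%G in
  swap_stable H /\
  exists u, (K :^ dg u 1)%g = G1 H \/ twistable H /\ (K :^ dg u 1)%g = G2 delta H.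
Proof.
move=> sP /subsetPn[g Kg ngd] H.
have [a [b ge]] := cartan_notdiag (subsetP sP g Kg) ngd; rewrite ge in Kg.
have Hab : (a * b)%g \in scal_part H.
  by rewrite inE in_setI dg_diag andbT {1}(unitC a) -antidiagM groupM.
have symH : swap_stable H.
  apply/swap_stableP; split; first exact: subsetIr.
  move=> c d; rewrite !in_setI !dg_diag !andbT => Kcd.
  by rewrite -(conj_antidiag a b c d) groupJ.
split=> //; have [s1 e1 g1] := G1_ext symH.
have Kmul c d : dg c d \in H -> (gam * dg (a * c) (b * d))%g \in K.
  by rewrite in_setI -dgM mulgA => /andP[Kcd _]; rewrite groupM.
(* An element of H of determinant 1 / ab turns gamma * diag(a, b) into one with invariant 1. *)
have case1 c d : dg c d \in H -> (a * b * (c * d) = 1)%g ->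
    exists u, (K :^ dg u 1)%g = G1 H.
  move=> /Kmul Kg' e; exists ((a * c)^-1 * 1)%g.
  have g1' : (gam * dg 1 1)%g \in G1 H by rewrite dg1 mulg1.
  apply: (antidiag_ext_conj sP s1 _ Kg' g1'); first by rewrite e1.
  have -> : (a * c * (b * d) = a * b * (c * d))%g by ufield.
  by rewrite e mulg1.
have [/existsP[c /existsP[d /andP[Hcd /squaresP[x Sx e]]]]|noex] :=
    boolP [exists c, exists d, (dg c d \in H) && ((a * b * (c * d))%g \in squares (scal_part H))].
  (* Dividing by the scalar x of H makes the determinant of diag(c, d) equal to 1 / ab. *)
  have Hcd' : dg (c * x^-1) (d * x^-1)%g \in H.
    by rewrite -dgM groupM // -dgV groupV; rewrite inE in Sx.
  have [|u Ku] := case1 _ _ Hcd'; last by exists u; left.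
  rewrite -[RHS](mulgV (x ^+ 2)%g) -{1}e; ufield.
have nsq c d : dg c d \in H -> (a * b * (c * d))%g \notin squares (scal_part H).
  move=> Hcd; apply: contra noex => sqcd.
  by apply/existsP; exists c; apply/existsP; exists d; rewrite Hcd.
have nsab : (a * b)%g \notin squares (scal_part H).
  by have := nsq 1%g 1%g; rewrite dg1 !mulg1; apply; apply: group1.
have tw : twistable H.
  apply/andP; split.
    apply/(det_set_squaresP symH) => c d Hcd; apply: contraT => nscd.
    case/negP: (nsq c d Hcd).
    apply: (nonsquareM (cyclic_unit _) Hab) => //.
    exact: scal_part_mul.
  have := nonsquare_minus1 Hab nsab; rewrite inE => Hm.
  by rewrite dg_neg_one.
have := nonsquareM (cyclic_unit _) Hab (twist_mem H) nsab (twist_nonsquare tw).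
case/squaresP => x Sx e.
(* As ab * twist H = x^2, multiplying both entries by twist H / x turns the product ab into
   twist H. *)
have Hx : dg (twist H * x^-1) (twist H * x^-1)%g \in H.
  have : (twist H * x^-1)%g \in scal_part H by rewrite groupM ?groupV ?twist_mem.
  by rewrite inE.
have [s2 e2 g2] := G2_ext symH.
have Kg' := Kmul _ _ Hx.
eexists; right; split=> //; apply: (antidiag_ext_conj sP s2 _ Kg' g2); first by rewrite e2.
rewrite twistE -[RHS]mulg1 -(mulgV (x ^+ 2)%g) -{1}e; ufield.
Qed.

End Delta.
End Extensions.

(** * Dihedral images *)

Section Dihedral.
Implicit Types gT rT : finGroupType.

Lemma dihedral_isog gT rT (A : {group gT}) (B : {group rT}) :
  A \isog B -> dihedral A -> dihedral B.
Proof.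
move=> isoAB; rewrite /dihedral (card_isog isoAB) => /and3P[-> -> isoD] /=.
by apply: isog_trans isoD; rewrite isog_sym.
Qed.

Lemma dihedral_presentation gT (A : {group gT}) : dihedral A ->
  exists x y, [/\ (<[x]> <*> <[y]>)%g = A, (y ^+ 2 = 1)%g & (x ^ y = x^-1)%g].
Proof.
move=> /and3P[A3 eA isoD]; have [q q1 cA] : exists2 q, (1 < q)%N & #|A| = q.*2.
  by exists #|A|./2; [move: A3; case: #|A| => [|[|[|[|]]]] // | rewrite even_halfK].
have := Grp_dihedral q1 A; rewrite -cA isog_hom // => /esym/existsP[[x y] /=].
by rewrite !xpair_eqE => /and4P[/eqP ? _ /eqP ? /eqP ?]; exists x, y.
Qed.

(** In a commutative group the relation x ^ y = x^-1 forces x^2 = 1, so the exponent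
divides two while the order is at least four. *)
Lemma dihedral_noncyclic gT (A : {group gT}) : dihedral A -> ~~ cyclic A.
Proof.
move=> dA; apply/negP => cA; have [x [y [genA y2 xy]]] := dihedral_presentation dA.
have /and3P[A3 _ _] := dA.
have abA := cyclic_abelian cA.
have Ax : x \in A by rewrite -genA (subsetP (joing_subl _ _)) ?cycle_id.
have Ay : y \in A by rewrite -genA (subsetP (joing_subr _ _)) ?cycle_id.
have x2 : (x ^+ 2 = 1)%g.
  have e : (x ^ y)%g = x by rewrite conjgE (centsP abA _ Ax _ Ay) mulKg.
  by rewrite expgS expg1 -{1}(invgK x) -xy e mulVg.
have exp2 : (exponent A %| 2)%N.
  apply/exponentP; rewrite -genA => a; rewrite norm_joinEl.
    case/mulsgP => u v /cycleP[i ->] /cycleP[j ->] ->.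
    rewrite expgMn; last by apply: (centsP abA); rewrite groupX.
    by rewrite -!expgM ![(_ * 2)%N]mulnC !expgM x2 y2 !expg1n mulg1.
  by apply: cents_norm; apply: (sub_abelian_cent2 abA); rewrite cycle_subG.
have [w defA] := cyclicP cA.
have := dvdn_leq (isT : (0 < 2)%N) exp2.
by rewrite defA exponent_cycle orderE -defA leqNgt (leq_trans _ A3).
Qed.

(** Such an A satisfies the relations of the dihedral group of order twice that of C,
and it is at least that large. *)
Lemma dihedral_inverted gT (A C : {group gT}) (y : gT) :
  cyclic C -> (1 < #|C|)%N -> y \notin C -> (C <*> <[y]>)%g = A -> (y ^+ 2 = 1)%g ->
  (forall c, c \in C -> c ^ y = c^-1)%g -> dihedral A.
Proof.
move=> /cyclicP[x defC] C1 nCy genA y2 invC.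
have sCA : C \subset A by rewrite -genA joing_subl.
have Ay : y \in A by rewrite -genA (subsetP (joing_subr _ _)) ?cycle_id.
have homA : A \homg 'D_(#|C|).*2.
  rewrite Grp_dihedral //; apply/existsP; exists (x, y); rewrite /= !xpair_eqE.
  rewrite -defC genA eqxx y2 invC ?defC ?cycle_id // -orderE expg_order !eqxx.
  by [].
have C2 : ((#|C|).*2 <= #|A|)%N.
  rewrite -(Lagrange sCA) -muln2 leq_mul2l indexg_gt1 orbC.
  by apply/orP; left; apply: contra nCy => /subsetP ->.
have isoD : A \isog 'D_(#|C|).*2 by rewrite isogEcard homA card_dihedral.
have cA : #|A| = (#|C|).*2 by rewrite (card_isog isoD) card_dihedral.
apply/and3P; split; rewrite cA ?odd_double //.
by rewrite -[4%N]/(2.*2)%N leq_double.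
Qed.

End Dihedral.

Section Projective.
Variable l : nat.
Hypotheses (l_prime : prime l) (l_odd : odd l).
Notation U := (unitFp l).
Notation GL := (GL2 l).
Notation gam := (gam l).
Definition scalars : {group GL} := scalar_group_group l.
Notation Z := scalars.
Implicit Types (H G K L : {group GL}) (g h : GL) (a b c d x y : U).

Lemma scalar_central a g : commute (dg a a) g.
Proof. by apply: GL2P; rewrite !GL2M !dgE /=; ring. Qed.

Lemma scalar_norm (A : {set GL}) : A \subset 'N(Z)%g.
Proof.
apply/subsetP => g _; apply/normP/eqP; rewrite eqEcard cardJg leqnn andbT.
apply/subsetP => _ /imsetP[_ /scalP[a ->] ->].
by rewrite conjgE scalar_central mulKg dg_scal.
Qed.

(** Modulo scalars diag(a, b) is diag(a/b, 1). *)
Lemma diag_proj_cyclic : cyclic (diag_cartan l / Z)%g.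
Proof.
have mM : {in [set: U] &, {morph (fun u : U => dg u 1%g) : x y / (x * y)%g}}.
  by move=> x y _ _; rewrite dgM mulg1.
pose f := Morphism mM.
have -> : (diag_cartan l / Z)%g = ((f @* [set: U]) / Z)%g.
  apply/eqP; rewrite eqEsubset; apply/andP; split; last first.
    by apply: quotientS; apply/subsetP => _ /morphimP[u _ _ ->]; apply: dg_diag.
  apply/subsetP => _ /morphimP[_ _ /diagP[a [b ->]] ->].
  have -> : dg a b = (dg (a * b^-1) 1 * dg b b)%g by rewrite dgM mul1g mulgKV.
  rewrite morphM ?(subsetP (scalar_norm [set: _])) ?inE //=.
  rewrite [X in (_ * X)%g]coset_id ?dg_scal // mulg1.
  by apply: mem_quotient; rewrite -[dg _ 1]/(f (a * b^-1)%g) mem_morphim ?inE.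
by apply: quotient_cyclic; apply: morphim_cyclic; apply: cyclic_unit.
Qed.

Lemma proj_eq g h : coset Z g = coset Z h -> exists a, g = (dg a a * h)%g.
Proof.
move/rcoset_kercosetP; rewrite !(subsetP (scalar_norm [set: _])) ?inE //.
by move=> /(_ isT isT)/rcosetP[_ /scalP[a ->] ->]; exists a.
Qed.

(** An antidiagonal element inverts the diagonal matrices modulo scalars and has
scalar square. *)
Lemma ext_dihedral K : K \subset diag_cartan_plus l -> ~~ (K \subset diag_cartan l) ->
  ~~ (K :&: diag_cartan l \subset Z) -> dihedral (K / Z)%g.
Proof.
move=> sP /subsetPn[g Kg ngd] nsc.
have [a [b ge]] := cartan_notdiag (subsetP sP g Kg) ngd.
have nZ h : h \in 'N(Z)%g by apply: (subsetP (scalar_norm [set: _])); rewrite inE.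
set H := (K :&: diag_cartan l)%G; have sHD : H \subset diag_cartan l := subsetIr _ _.
apply: (@dihedral_inverted _ (K / Z)%G (H / Z)%G (coset Z g)).
- by apply: cyclicS diag_proj_cyclic; apply: quotientS.
- rewrite ltnNge -trivg_card_le1; apply: contra nsc => /eqP triv.
  by rewrite -quotient_sub1 ?scalar_norm // triv.
- apply/negP => /morphimP[h _ Hh /proj_eq[c e]].
  by case/negP: ngd; rewrite e groupM ?dg_diag // (subsetP sHD).
- apply/eqP; rewrite eqEsubset join_subG cycle_subG mem_quotient //.
  rewrite quotientS ?subsetIl //=; apply/subsetP => _ /morphimP[k _ Kk ->].
  have [Dk|nk] := boolP (k \in diag_cartan l).
    by rewrite (subsetP (joing_subl _ _)) // mem_quotient // in_setI Kk.
  rewrite -(mulKVg g k) morphM //= groupM //.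
    by rewrite (subsetP (joing_subr _ _)) ?cycle_id.
  by rewrite (subsetP (joing_subl _ _)) // mem_quotient // notdiag_div.
- rewrite -morphX //= coset_id // ge expgS expg1 antidiagM unitC dg_scal //.
- move=> _ /morphimP[h _ Hh ->]; have [c [d he]] := diagP _ (subsetP sHD h Hh).
  rewrite -morphJ // -morphV //= he ge conj_antidiag dgV.
  have -> : dg d c = (dg (d * c) (d * c) * dg c^-1 d^-1)%g.
    by rewrite dgM mulgK (unitC d) mulgK.
  by rewrite morphM //= [X in (X * _)%g]coset_id ?dg_scal // mul1g.
Qed.

(** If K were diagonal its image would be cyclic, and if its diagonal part were scalar
its image would have order at most two. *)
Lemma dihedral_ext K : K \subset diag_cartan_plus l -> dihedral (K / Z)%g ->
  ~~ (K \subset diag_cartan l) /\ ~~ (K :&: diag_cartan l \subset Z).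
Proof.
move=> sP dK; have nd : ~~ (K \subset diag_cartan l).
  apply: contra (dihedral_noncyclic dK) => sD.
  by apply: cyclicS diag_proj_cyclic; apply: quotientS.
split=> //; apply/negP => sZ; have /and3P[K3 _ _] := dK.
have /subsetPn[g Kg ngd] := nd.
have : (#|(K / Z)%g| <= #|[set 1%g; coset Z g]|)%N.
  apply: subset_leq_card; apply/subsetP => _ /morphimP[k _ Kk ->].
  rewrite in_set2; have [Dk|nk] := boolP (k \in diag_cartan l).
    have Zk : k \in Z by apply: (subsetP sZ); rewrite in_setI Kk.
    by rewrite /= (coset_id Zk) eqxx.
  have := notdiag_div sP Kg Kk ngd nk; move=> /(subsetP sZ) Zk.
  rewrite -(mulKVg g k) morphM ?(subsetP (scalar_norm [set: _])) ?inE //=.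
  by rewrite [X in (_ * X)%g]coset_id // mulg1 eqxx orbT.
rewrite cards2 leqNgt; case/negP; apply: leq_ltn_trans _ K3.
by case: (_ != _).
Qed.

(** The conjugates of diag(1, -1) under the normalizer are diagonal. *)
Lemma norm_diag_plus (A : {set GL}) : A \subset 'N(diag_cartan l)%g -> A \subset diag_cartan_plus l.
Proof.
move=> nA; apply/subsetP => x Ax; apply: (@diag_conj_plus l 1%g (minus1 l)).
  by rewrite eq_sym minus1_neq1.
by rewrite memJ_norm ?dg_diag // (subsetP nA).
Qed.

End Projective.

(** * Conjugacy classes of extensions *)

Section Classes.
Variable l : nat.
Hypotheses (l_prime : prime l) (l_odd : odd l).
Notation U := (unitFp l).
Notation GL := (GL2 l).
Notation gam := (gam l).
Notation Z := (scalars l).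
Notation minus1 := (minus1 l).
Notation D := (dg 1%g minus1).
Implicit Types (H G K L : {group GL}) (g h : GL) (a b c d x y : U).

Definition split_dihedral (K : {set GL}) : bool :=
  in_split_cartan_normalizer K && has_dihedral_image K.

Definition proper_ext (K : {set GL}) : bool :=
  [&& K \subset diag_cartan_plus l, ~~ (K \subset diag_cartan l)
    & ~~ (K :&: diag_cartan l \subset Z)]%g.

Lemma split_dihedralP K : reflect (exists (L : {group GL}) z, proper_ext L /\ K :=: (L :^ z)%g) (split_dihedral K).
Proof.
have dihJ (L : {group GL}) z : dihedral (L / Z)%g -> dihedral ((L :^ z)%G / Z)%g.
  apply: (@dihedral_isog _ _ (L / Z)%G ((L :^ z)%G / Z)%G).
  by rewrite /= quotientJ ?conj_isog // (subsetP (scalar_norm [set: _])) ?inE.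
apply: (iffP andP) => [[/existsP[z0 sN0] dK] | [L [z [/and3P[sP nd nsc] ->]]]].
  have [z sN] : exists z : GL, K \subset 'N((diag_cartan l : {set GL}) :^ z)%g by exists z0.
  exists (K :^ z^-1)%G, z; split; last by rewrite /= conjsgKV.
  have sP : (K :^ z^-1)%G \subset diag_cartan_plus l.
    by apply: norm_diag_plus => //; rewrite /= sub_conjgV -normJ.
  have [nd nsc] := dihedral_ext sP (dihJ K z^-1%g dK).
  exact/and3P.
split; last by apply: (dihJ L z); apply: ext_dihedral.
apply/existsP; exists z; rewrite normJ conjSg.
exact: subset_trans sP (cartan_plus_norm l).
Qed.

Lemma det_conj g z : \det (GLval (g ^ z)%g) = \det (GLval g).
Proof.
rewrite conjgE det_GLM det_GLM mulrCA -det_GLM mulVg.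
by rewrite -(@dg1 l) det_dg /= !mulr1.
Qed.

Lemma mem_conj (A B : {set GL}) g z : (A :^ z = B)%g -> (g \in A) = ((g ^ z)%g \in B).
Proof. by move=> <-; rewrite memJ_conjg. Qed.

Lemma plus_norm H : swap_stable H -> diag_cartan_plus l \subset 'N(H)%g.
Proof.
move=> symH; have sD := sub_diag symH; apply/subsetP => g /cartan_plusP[Dg|[a [b ->]]].
  apply: (subsetP (cents_norm _) _ Dg); exact: (sub_abelian_cent (diag_abelian l)).
apply/normP/eqP; rewrite eqEcard cardJg leqnn andbT.
apply/subsetP => _ /imsetP[h Hh ->]; have [c [d e]] := diagP _ (subsetP sD h Hh).
by rewrite e conj_antidiag swap_stableE // -e.
Qed.

(** This says that the image of a diagonal group H in PGL_2 has order at most two, so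
that the extensions of H have at most a Klein image. *)
Definition klein (H : {set GL}) : bool :=
  [forall a : U, forall b : U, (dg a b \in H) ==> (a ^+ 2 == b ^+ 2)%g].

Lemma kleinP H : reflect (forall a b, dg a b \in H -> b = a \/ b = (minus1 * a)%g) (klein H).
Proof.
apply: (iffP forallP) => [kH a b Hab | kH a].
  have /forallP/(_ b)/implyP/(_ Hab)/eqP e := kH a.
  exact: unit_sq_eq.
apply/forallP => b; apply/implyP => /kH[->//|->].
by rewrite expgMn ?minus1_sq ?mul1g //; apply: unitC.
Qed.

(** If the conjugate of the diagonal part is another index two subgroup, it contains
an antidiagonal element y. Squares of G' lie in that conjugate, which is abelian, so
squares of diagonal elements commute with y, and a diagonal matrix commuting with y is
scalar. *)
Lemma klein_of_conj G G' z : G \subset diag_cartan_plus l -> G' \subset diag_cartan_plus l ->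
  ~~ (G' \subset diag_cartan l) -> (G :^ z)%g = G' ->
  ((G :&: diag_cartan l) :^ z)%g != (G' :&: diag_cartan l)%g ->
  klein (G' :&: diag_cartan l)%g.
Proof.
move=> sP sP' nd' conjG neqH.
have memG g := mem_conj g conjG.
have [y Hy nDy] : exists2 y, y \in ((G :&: diag_cartan l) :^ z)%g & y \notin diag_cartan l.
  apply/subsetPn; apply: contra neqH => sD; rewrite eqEsubset.
  rewrite subsetI sD -{1}conjG conjSg subsetIl /=.
  apply/subsetP => h'; rewrite in_setI => /andP[Gh' Dh'].
  have [h hh'] : exists h, h' = (h ^ z)%g by exists (h' ^ z^-1)%g; rewrite conjgKV.
  rewrite hh' memJ_conjg in_setI memG -hh' Gh' /=; apply: contraR nd' => nh.
  apply/subsetP => k' Gk'.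
  have [k kk'] : exists k, k' = (k ^ z)%g by exists (k' ^ z^-1)%g; rewrite conjgKV.
  have Gh : h \in G by rewrite memG -hh'.
  have Gk : k \in G by rewrite memG -kk'.
  have [Dk|nk] := boolP (k \in diag_cartan l).
    by apply: (subsetP sD); rewrite kk' memJ_conjg in_setI Gk.
  have := notdiag_div sP Gh Gk nh nk; rewrite -(memJ_conjg _ z) => /(subsetP sD).
  by rewrite conjMg conjVg -hh' -kk' groupMl // groupV.
have nDGy : y \in G'.
  by move: Hy; rewrite conjIg conjG => /setIP[].
have [c [d yE]] := cartan_notdiag (subsetP sP' y nDGy) nDy.
apply/forallP => a; apply/forallP => b; apply/implyP; rewrite in_setI => /andP[Gab _].
have Hsq : (dg a b ^+ 2)%g \in ((G :&: diag_cartan l) :^ z)%g.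
  have [h hh'] : exists h, dg a b = (h ^ z)%g by exists (dg a b ^ z^-1)%g; rewrite conjgKV.
  rewrite hh' -conjXg memJ_conjg in_setI.
  have Gh : h \in G by rewrite memG -hh'.
  rewrite groupX //=; have [Dh|nh] := boolP (h \in diag_cartan l); first exact: groupX.
  by rewrite expgS expg1 notdiagM // (subsetP sP).
have abH : abelian ((G :&: diag_cartan l) :^ z)%g.
  by rewrite abelianJ (abelianS (subsetIr _ _) (diag_abelian l)).
have := centsP abH _ Hsq _ Hy; rewrite dgX yE => /commgP/conjg_fixP.
by rewrite conj_antidiag => /dg_inj[-> _].
Qed.

Lemma scal_part_conj G G' z : (G :^ z)%g = G' ->
  scal_part (G :&: diag_cartan l)%g = scal_part (G' :&: diag_cartan l)%g.
Proof.
move=> conjG; apply/setP => a; rewrite [LHS]in_set [RHS]in_set.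
rewrite !in_setI !dg_diag !andbT (mem_conj _ conjG).
by rewrite conjgE scalar_central mulKg.
Qed.

Lemma dg_minus1E a : dg a (minus1 * a)%g = (dg a a * D)%g.
Proof. by rewrite dgM mulg1 (unitC a). Qed.

Lemma klein_mem_sub H H' : swap_stable H -> klein H -> D \in H -> D \in H' ->
  scal_part H \subset scal_part H' -> H \subset H'.
Proof.
move=> symH /kleinP kH HD HD' /subsetP sS; apply/subsetP => h Hh.
have [a [b e]] := diagP _ (subsetP (sub_diag symH) h Hh); rewrite e in Hh *.
have sc c : dg c c \in H -> dg c c \in H' by move=> Hc; have := sS c; rewrite !inE; apply.
move: (Hh); case: (kH a b Hh) => -> {}Hh; first exact: sc.
by rewrite dg_minus1E groupM // sc // -(groupMr _ HD) -dg_minus1E.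
Qed.

(** Were a^2 = s^2 with s in the scalar part, then a = s or a = -s would lie there
too, and dividing diag(a, -a) by a would give diag(1, -1). *)
Lemma klein_nonsquare H a : swap_stable H -> D \notin H -> dg a (minus1 * a)%g \in H ->
  [/\ minus1 \in scal_part H, a \notin scal_part H, (a ^+ 2)%g \in scal_part H
     & (a ^+ 2)%g \notin squares (scal_part H)].
Proof.
move=> symH HD Ha.
have mS : minus1 \in scal_part H.
  rewrite inE; have -> : dg minus1 minus1 = (dg (minus1 * a) a * (dg a (minus1 * a))^-1)%g.
    rewrite dgV dgM mulgK invMg mulKVg; congr (dg _ _).
    by rewrite minus1V.
  by rewrite groupM ?groupV // swap_stableE.
have aS : a \notin scal_part H.
  apply: contra HD; rewrite inE => Haa; rewrite -(groupMl _ Haa) -dg_minus1E //.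
split=> //.
  have := groupX 2 Ha; rewrite dgX inE expgMn ?minus1_sq ?mul1g //; exact: unitC.
apply: contra aS => /squaresP[s Ss /unit_sq_eq[->//|->]]; exact: groupM.
Qed.

(** If diag(p, -p) is in H and diag(a, -a) in H', then p^2 and a^2 are nonsquares of
the common scalar part, so (pa)^2 is a square there and pa is a scalar of H'. *)
Lemma klein_notmem_sub H H' a : swap_stable H -> swap_stable H' -> klein H ->
  D \notin H -> D \notin H' -> dg a (minus1 * a)%g \in H' ->
  scal_part H = scal_part H' -> H \subset H'.
Proof.
move=> symH symH' /kleinP kH nD nD' Ha eS; apply/subsetP => h Hh.
have [p [q e]] := diagP _ (subsetP (sub_diag symH) h Hh); rewrite e in Hh *.
have sc c : c \in scal_part H' -> dg c c \in H' by rewrite inE.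
move: (Hh); case: (kH p q Hh) => -> {}Hh; first by apply: sc; rewrite -eS inE.
have [mS aS a2 a2n] := klein_nonsquare symH' nD' Ha.
have [_ _ p2 p2n] := klein_nonsquare symH nD Hh.
rewrite eS in p2 p2n.
have /squaresP[s Ss] := nonsquareM (cyclic_unit [group of scal_part H']) p2 a2 p2n a2n.
rewrite -expgMn => [/unit_sq_eq e2|]; last exact: unitC.
have Spa : (p * a)%g \in scal_part H' by case: e2 => ->; rewrite ?groupM.
have -> : dg p (minus1 * p)%g = (dg (p * a) (p * a) * dg a (minus1 * a) * (dg (a ^+ 2) (a ^+ 2))^-1)%g.
  rewrite dgV !dgM; congr dg; ufield.
by rewrite !groupM ?groupV ?sc.
Qed.

Section Delta.
Variables d1 d2 : U.
Hypothesis gen : <[d1 * d2]>%g = [set: U].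
Notation delta := (dg d1 d2).

(** The boolean is the twist: it selects G2 rather than G1. *)
Definition extension (p : {group GL} * bool) : {group GL} :=
  if p.2 then G2 delta p.1 else G1 p.1.

Definition pairs : {set {group GL} * bool} :=
  [set p : {group GL} * bool | @admissible l p.1 && (p.2 ==> @twistable l p.1)].

(** The untwisted extensions of these H are conjugate to extensions of the group
containing diag(1, -1) with the same scalars. *)
Definition redundant : {set {group GL} * bool} :=
  [set p : {group GL} * bool | [&& @admissible l p.1, ~~ p.2, klein p.1 & D \notin p.1]].

Lemma extension_facts p : p \in pairs ->
  [/\ swap_stable p.1, proper_ext (extension p) & (extension p :&: diag_cartan l)%g = p.1].
Proof.
case: p => H b; rewrite inE /= admissibleE => /andP[/andP[symH nsc] tw].
rewrite /extension /=; case: b tw => /= [tw|_].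
  have [sP eH gG] := G2_ext l_prime gen symH; split=> //; apply/and3P; split=> //.
    by apply/subsetPn; eexists; [exact: gG | exact: antidiag_notin].
  by rewrite eH.
have [sP eH gG] := G1_ext symH; split=> //; apply/and3P; split=> //.
  by apply/subsetPn; exists gam; rewrite // -[gam]mulg1 -dg1 antidiag_notin.
by rewrite eH.
Qed.

Lemma det_G2_notin H g : swap_stable H -> twistable H ->
  g \in G2 delta H -> g \notin H -> - \det (GLval g) \notin det_set H.
Proof.
move=> symH tw Gg nHg; have := det_G2 l_prime l_odd gen symH tw.
rewrite disjoint_sym => /disjointFr -> //.
by apply/imsetP; exists g; rewrite // in_setD nHg.
Qed.

Lemma det_set1 H : 1 \in det_set H.
Proof. by apply/imsetP; exists (1%g : GL) => //; rewrite -dg1 det_dg mulg1. Qed.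

(** If diag(1, -1) is in H, the determinants of G1 H form the group det H, which
contains -1, whereas G2 H has others. Otherwise the conjugate of gamma is outside H
and has determinant -1, although 1 is in det H. *)
Lemma G1_G2_not_conj H z : swap_stable H -> twistable H -> (H :^ z = H)%g \/ D \in H ->
   (G1 H :^ z)%g = G2 delta H -> False.
Proof.
move=> symH tw zH conjG; have [sP eH gG] := G1_ext symH.
have ng : gam \notin H.
  have := @antidiag_notin l 1 1; rewrite dg1 mulg1.
  by apply: contra => /(subsetP (sub_diag symH)).
have [HD|nD] := boolP (D \in H).
  have [_ eH2 gG2] := G2_ext l_prime gen symH.
  set g := (gam * _)%g in gG2.
  have ngD : g \notin diag_cartan l by apply: antidiag_notin.
  have nHg : g \notin H by apply: contra ngD => /(subsetP (sub_diag symH)).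
  have /negP[] := det_G2_notin symH tw gG2 nHg.
  have Gg : (g ^ z^-1)%g \in G1 H by rewrite (mem_conj _ conjG) conjgKV.
  rewrite -(det_conj g z^-1).
  have [Hg'|nHg'] := boolP ((g ^ z^-1)%g \in H).
    apply/imsetP; exists ((g ^ z^-1) * D : GL)%g; first by rewrite groupM.
    by rewrite (det_GLM _ D) det_dg mul1g mulrN1.
  rewrite (det_G1 symH); apply/imsetP; exists (g ^ z^-1)%g => //.
  by rewrite in_setD nHg'.
case: zH => [zH|/(negP nD)//].
have gG2 : (gam ^ z)%g \in G2 delta H by rewrite -(mem_conj _ conjG).
have := det_G2_notin symH tw gG2; rewrite -(mem_conj _ zH) => /(_ ng).
by rewrite det_conj det_gamma opprK det_set1.
Qed.

(** The second extension must be twisted, so det H' consists of squares of its scalar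
part. The conjugate of diag(1, -1) has determinant -1, which is not in det H', as a^2
is a nonsquare for diag(a, -a) in H', and which does not occur outside H', as 1 is in
det H'. *)
Lemma klein_exclusive p p' z : p \in pairs -> p' \in pairs :\: redundant ->
  klein p'.1 -> D \in p.1 -> D \notin p'.1 -> (extension p :^ z)%g = extension p' -> False.
Proof.
move=> Pp; rewrite in_setD => /andP[nr' Pp'] k' HD nD' conjG.
have [symH _ eH] := extension_facts Pp; have [symH' ext' eH'] := extension_facts Pp'.
case: p' => H' b' /= in nr' Pp' k' nD' conjG symH' ext' eH' *.
have tw' : b' /\ twistable H'.
  move: nr' Pp'; rewrite !inE /= => nr' /andP[adm].
  by move: nr'; rewrite adm k' nD' /= andbT negbK => ->.
have {tw'} [b'T tw'] := tw'.
have {}conjG : (extension p :^ z)%g = G2 delta H' by rewrite conjG /extension b'T.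
have DG0 : D \in extension p by move: HD; rewrite -{1}eH => /setIP[].
have DG : (D ^ z)%g \in G2 delta H'.
  by rewrite -(mem_conj _ conjG).
have detD : \det (GLval (D ^ z)%g) = -1 by rewrite det_conj det_dg mul1g.
have [HD'|nHD'] := boolP ((D ^ z)%g \in H'); last first.
  by have := det_G2_notin symH' tw' DG nHD'; rewrite detD opprK det_set1.
have sq := det_set_squaresP symH' (proj1 (andP tw')).
have msq : minus1 \in squares (scal_part H').
  have [a [b e]] := diagP _ (subsetP (sub_diag symH') _ HD').
  have := sq a b; rewrite -e HD'; have -> : minus1 = (a * b)%g; last by apply.
  by apply: val_inj; rewrite -det_dg -e detD.
have nsc : ~~ (H' \subset scalar_group l).
  by move: Pp'; rewrite inE /= admissibleE => /andP[/andP[]].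
have [a [b [ab Hab]]] := nonscalarP (sub_diag symH') nsc.
move: ab (Hab); case: (kleinP _ k' a b Hab) => ->; rewrite ?eqxx // => _ {}Hab.
have [_ _ _ /negP[]] := klein_nonsquare symH' nD' Hab.
have -> : (a ^+ 2 = minus1 * (a * (minus1 * a)))%g by ufield.
apply: (@squaresM _ (scal_part_group H')); [exact: abelian_unit | exact: msq | exact: sq].
Qed.

(** Either z normalizes the diagonal group, and then H = H', or both images are Klein
groups; these H are determined by their scalars and by whether they contain
diag(1, -1). *)
Lemma extension_conj_inj p p' z : p \in pairs :\: redundant -> p' \in pairs :\: redundant ->
  (extension p :^ z)%g = extension p' -> p = p'.
Proof.
move=> Ip Ip' conjG.
have /setDP[Pp nr] := Ip; have /setDP[Pp' nr'] := Ip'.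
have [symH xt eH] := extension_facts Pp; have [symH' xt' eH'] := extension_facts Pp'.
have conjG' : (extension p' :^ z^-1)%g = extension p by rewrite -conjG conjsgK.
have same : p.1 = p'.1 -> (p.1 :^ z)%g = p.1 \/ D \in p.1 -> p = p'.
  case: p p' {Ip Ip' nr nr' symH symH' xt xt' eH eH'} Pp Pp' conjG conjG' => H b [H' b'] /= Pp Pp' conjG conjG' eHH; subst H'.
  move: Pp Pp' conjG conjG'; rewrite !inE /extension /= => /andP[adm tw] /andP[_ tw'].
  have symH : swap_stable H by move: adm; rewrite admissibleE => /andP[].
  case: b b' tw tw' => -[] //= tw tw' conjG conjG' zH; exfalso.
    apply: (G1_G2_not_conj symH tw _ conjG'); case: zH; [left|by right].
    by rewrite -{1}a conjsgK.
  exact: (G1_G2_not_conj symH tw' zH conjG).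
have [e|neq] := eqVneq (p.1 :^ z)%g p'.1.
  have zz : (p.1 :^ z)%g = p.1.
    have nsc : ~~ (p.1 \subset scalar_group l).
      by move: Pp; rewrite inE admissibleE => /andP[/andP[]].
    have [a [b [ab Hab]]] := nonscalarP (sub_diag symH) nsc.
    have Pz : z \in diag_cartan_plus l.
      apply: (diag_conj_plus ab); apply: (subsetP (sub_diag symH')).
      by rewrite -e memJ_conjg.
    exact/normP/(subsetP (plus_norm symH)).
  by apply: same; [apply: val_inj; rewrite /= -zz | left].
have /and3P[sP nd _] := xt; have /and3P[sP' nd' _] := xt'.
have k' : klein p'.1.
  by rewrite -eH'; apply: (klein_of_conj sP sP' nd' conjG); rewrite eH eH'.
have k : klein p.1.
  rewrite -eH; apply: (klein_of_conj sP' sP nd conjG'); rewrite eH eH'.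
  by apply: contra neq => /eqP <-; rewrite conjsgKV.
have eS : scal_part p.1 = scal_part p'.1 by rewrite -eH -eH'; apply: scal_part_conj conjG.
have [HD|nD] := boolP (D \in p.1); have [HD'|nD'] := boolP (D \in p'.1).
- apply: same; last by right.
  apply/val_inj/eqP; rewrite eqEsubset !klein_mem_sub ?eS //.
- by case: (klein_exclusive Pp Ip' k' HD nD' conjG).
- by case: (klein_exclusive Pp' Ip k HD' nD conjG').
have nonsc q : q \in pairs -> klein q.1 -> swap_stable q.1 -> exists a, dg a (minus1 * a)%g \in q.1.
  rewrite inE admissibleE => /andP[/andP[_ nsc] _] /kleinP kq symq.
  have [a [b [ab Hab]]] := nonscalarP (sub_diag symq) nsc.
  by move: ab (Hab); case: (kq a b Hab) => ->; rewrite ?eqxx // => _ {}Hab; exists a.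
have [a Ha] := nonsc _ Pp k symH; have [a' Ha'] := nonsc _ Pp' k' symH'.
have eHH : p.1 = p'.1.
  apply/val_inj/eqP; rewrite eqEsubset.
  by rewrite (klein_notmem_sub symH symH' k nD nD' Ha') // (klein_notmem_sub symH' symH k' nD' nD Ha).
have snd_true q : q \in pairs -> q \notin redundant -> klein q.1 -> D \notin q.1 -> q.2.
  rewrite !inE => /andP[adm _]; rewrite adm => nrq kq nq; move: nrq.
  by rewrite kq nq /= andbT negbK.
by rewrite (surjective_pairing p) (surjective_pairing p') eHH !snd_true.
Qed.

(** The matrix [1 1; 1 -1], which exchanges the eigenlines of gamma and of
diag(1, -1). *)
Definition hadamard_mx : 'M['F_l]_2 := \matrix_(i, j) (if (i == 1) && (j == 1) then -1 else 1).

Lemma hadamard_mx_unit : hadamard_mx \is a GRing.unit.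
Proof.
rewrite unit_det det_mx2 !mxE /= mul1r mulr1 unitfE -opprD oppr_eq0.
by apply: contra (Fp_neqN1 l_prime l_odd); rewrite addr_eq0.
Qed.

Definition hadamard : GL := FinRing.unit _ hadamard_mx_unit.

Lemma hadamardE (i j : 'I_2) : (GLval hadamard) i j = if (i == 1) && (j == 1) then -1 else 1.
Proof. by rewrite mxE. Qed.

Lemma hadamard_gam : (gam ^ hadamard)%g = D.
Proof.
apply: (mulgI hadamard); rewrite -conjgC.
by apply: GL2P; rewrite !(GL2M, dgE, gammaE, hadamardE) /=; ring.
Qed.

Lemma hadamard_D : (D ^ hadamard)%g = gam.
Proof.
apply: (mulgI hadamard); rewrite -conjgC.
by apply: GL2P; rewrite !(GL2M, dgE, gammaE, hadamardE) /=; ring.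
Qed.

Lemma scalar_conj a z : (dg a a ^ z)%g = dg a a.
Proof. by rewrite conjgE scalar_central mulKg. Qed.

Lemma proper_ext_class K : proper_ext K ->
  exists p z, [/\ p \in pairs, K :=: (extension p :^ z)%g & p.1 = (K :&: diag_cartan l)%G].
Proof.
move=> /and3P[sP nd nsc].
have [symH [u Hu]] := classification l_prime l_odd gen sP nd.
have adm : admissible (K :&: diag_cartan l)%G by rewrite admissibleE symH.
have back (L : {group GL}) : (K :^ dg u 1)%g = L -> K :=: (L :^ (dg u 1)^-1)%g.
  by move=> <-; rewrite conjsgK.
case: Hu => [/back e | [tw /back e]].
  by exists ((K :&: diag_cartan l)%G, false), (dg u 1)^-1%g; rewrite inE /= adm.
by exists ((K :&: diag_cartan l)%G, true), (dg u 1)^-1%g; rewrite inE /= adm tw.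
Qed.

(** Conjugation by the Hadamard matrix maps gamma to diag(1, -1) and diag(a, -a) to an
antidiagonal element, so the diagonal part of the new group contains diag(1, -1). *)
Lemma redundant_conj p : p \in redundant ->
  exists p' z, p' \in pairs :\: redundant /\ extension p :=: (extension p' :^ z)%g.
Proof.
case: p => H b; rewrite inE /= => /and4P[adm nb /kleinP kH nD].
have symH : swap_stable H by move: adm; rewrite admissibleE => /andP[].
have nsc : ~~ (H \subset scalar_group l) by move: adm; rewrite admissibleE => /andP[].
rewrite /extension /= (negPf nb); have [sP eH gG] := G1_ext symH.
pose K := (G1 H :^ hadamard)%G.
have KD : D \in K by rewrite -hadamard_gam memJ_conjg.
have hadH h : h \in H -> (h ^ hadamard)%g \in diag_cartan_plus l.
  move=> Hh; have [a [c e]] := diagP _ (subsetP (sub_diag symH) h Hh).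
  rewrite e in Hh *; case: (kH a c Hh) => ->.
    by rewrite scalar_conj (subsetP (diag_plus l)) ?dg_diag.
  rewrite dg_minus1E conjMg scalar_conj hadamard_D dg_gamma.
  by apply/cartan_plusP; right; exists a, a.
have sPK : K \subset diag_cartan_plus l.
  rewrite /= -genJ (gen_subG _ (cartan_plus_group l)) conjUg subUset.
  apply/andP; split; first by apply/subsetP => _ /imsetP[h Hh ->]; apply: hadH.
  by rewrite conjg_set1 sub1set hadamard_gam (subsetP (diag_plus l)) ?dg_diag.
have extK : proper_ext K.
  apply/and3P; split=> //.
    have [a [c [ac Hac]]] := nonscalarP (sub_diag symH) nsc.
    apply/subsetPn; exists (dg a c ^ hadamard)%g.
      by rewrite memJ_conjg; move: Hac; rewrite -{1}eH => /setIP[].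
    move: ac; case: (kH a c Hac) => ->; rewrite ?eqxx // => _.
    by rewrite dg_minus1E conjMg scalar_conj hadamard_D dg_gamma antidiag_notin.
  apply/subsetPn; exists D; first by rewrite in_setI KD dg_diag.
  by rewrite dg_scal eq_sym minus1_neq1.
have [p' [z [Pp' eK ep]]] := proper_ext_class extK.
exists p', (z * hadamard^-1)%g; split; last by rewrite conjsgM -eK /= conjsgK.
rewrite in_setD Pp' andbT inE ep /= in_setI KD dg_diag /= !andbF //.
Qed.

Definition conj_class (K : {set GL}) : {set {set GL}} := (K :^: [set: GL])%g.

Lemma conj_classP (K L : {set GL}) :
  reflect (exists z, K = (L :^ z)%g) (conj_class K == conj_class L).
Proof.
apply: (iffP eqP) => [e | [z ->]].
  have : K \in conj_class K by apply/imsetP; exists 1%g; rewrite ?inE ?conjsg1.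
  by rewrite e => /imsetP[z _ ->]; exists z.
apply/setP => A; apply/imsetP/imsetP => [[y _ ->]|[y _ ->]].
  by exists (z * y)%g; rewrite ?inE // conjsgM.
by exists (z^-1 * y)%g; rewrite ?inE // conjsgM conjsgK.
Qed.

Lemma card_classes :
  #|[set conj_class K | K : {group GL} & split_dihedral K]| = #|pairs :\: redundant|.
Proof.
have inj : {in pairs :\: redundant &, injective (fun p => conj_class (extension p))}.
  move=> p p' Ip Ip' /eqP/conj_classP[z e].
  by apply/esym/(extension_conj_inj Ip' Ip (z := z)).
rewrite -(card_in_imset inj); apply: eq_card => A; apply/imsetP/imsetP.
  case=> K; rewrite inE => /split_dihedralP[L [z [xL eK]]] ->.
  have [p [y [Pp eL _]]] := proper_ext_class xL.
  have eKp : K :=: (extension p :^ (y * z))%g by rewrite eK eL conjsgM.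
  have [r|nr] := boolP (p \in redundant); last first.
    exists p; first by rewrite in_setD nr.
    by apply/eqP/conj_classP; exists (y * z)%g.
  have [p' [x [Pp' ep]]] := redundant_conj r; exists p' => //.
  by apply/eqP/conj_classP; exists (x * (y * z))%g; rewrite eKp ep -conjsgM.
case=> p /setDP[Pp _] ->; exists (extension p) => //; rewrite inE.
apply/split_dihedralP; exists (extension p), 1%g; rewrite conjsg1; split=> //.
by have [] := extension_facts Pp.
Qed.

Lemma card_pairs : (#|pairs :\: redundant| +
    #|[set H : {group GL} | [&& @admissible l H, klein H & D \notin H]]|)%N =
  (#|[set H : {group GL} | @admissible l H]|
    + #|[set H : {group GL} | @admissible l H && @twistable l H]|)%N.
Proof.
have pairE : pairs = setX [set H : {group GL} | @admissible l H] [set false]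
    :|: setX [set H : {group GL} | @admissible l H && @twistable l H] [set true].
  by apply/setP => -[H []]; rewrite !inE /= ?(andbT, andbF, orbF).
have redE : redundant =
    setX [set H : {group GL} | [&& @admissible l H, klein H & D \notin H]] [set false].
  by apply/setP => -[H []]; rewrite !inE /= ?(andbT, andbF).
have sub : redundant \subset pairs.
  by apply/subsetP => -[H b]; rewrite !inE /= => /and4P[-> /negPf -> _ _].
have := cardsID redundant pairs; rewrite (setIidPr sub) {1}redE {2}pairE.
rewrite cardsU disjoint_setI0 ?cards0 ?subn0 ?cardsX ?cards1 ?muln1 1?addnC //.
apply/pred0Pn => -[[H b]] /=; rewrite !inE /= => /andP[/andP[_ /eqP->]].
by rewrite andbF.
Qed.

End Delta.
End Classes.

(** * Swap-stable subgroups and pairs of subgroups of F_l^* *)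

Section Counting.
Variable l : nat.
Hypotheses (l_prime : prime l) (l_odd : odd l).
Notation U := (unitFp l).
Notation GL := (GL2 l).
Notation minus1 := (minus1 l).
Notation D := (dg 1%g minus1).
Notation UU := ({group U} * {group U})%type.
Implicit Types (H : {group GL}) (S T : {group U}) (a b c d x y u : U).

Definition scal_anti_parts H : UU := (scal_part_group H, anti_part_group H).

(** Equivalently, H is the product of its scalars and its intersection with SL_2; this
form is the first half of the definition of twistable. *)
Definition is_product H := det_set H == det_set (H :&: scalar_group l)%g.

Lemma product_parts_inj H H' : swap_stable H -> swap_stable H' -> is_product H ->
  scal_anti_parts H = scal_anti_parts H' -> H \subset H'.
Proof.
move=> symH symH' spH [eS eT]; apply/subsetP => h Hh.
have [a [b e]] := diagP _ (subsetP (sub_diag symH) h Hh); rewrite e in Hh *.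
have /squaresP[x Sx ex] := det_set_squaresP symH spH a b Hh.
have [Ty be] := split_scal Hh Sx ex.
have ae : a = (x * (a * x^-1))%g by rewrite (unitC a) mulKVg.
rewrite /= eS in Sx; rewrite /= eT in Ty.
by rewrite be {1}ae mem_scal_anti.
Qed.

Lemma nonproduct_witness H : swap_stable H -> ~~ is_product H ->
  exists a b, dg a b \in H /\ (a * b)%g \notin squares (scal_part H).
Proof.
move=> symH nsp.
have : ~~ [forall a : U, forall b : U, (dg a b \in H) ==> ((a * b)%g \in squares (scal_part H))].
  apply: contra nsp => /forallP h; apply/(det_set_squaresP symH) => a b Hab.
  by have /forallP/(_ b)/implyP := h a; apply.
rewrite negb_forall => /existsP[a]; rewrite negb_forall => /existsP[b].
by rewrite negb_imply => /andP[]; exists a, b.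
Qed.

(** An element of H outside the product differs from one of H' outside the product by
a matrix both of whose invariants are squares, and such a matrix is in the product. *)
Lemma nonproduct_parts_inj H H' : swap_stable H -> swap_stable H' -> ~~ is_product H -> ~~ is_product H' ->
  scal_anti_parts H = scal_anti_parts H' -> H \subset H'.
Proof.
move=> symH symH' nsp nsp' [eS eT]; apply/subsetP => h Hh.
have [c [d [H'cd nscd]]] := nonproduct_witness symH' nsp'.
have [a [b e]] := diagP _ (subsetP (sub_diag symH) h Hh); rewrite e in Hh *.
have eSs : scal_part H = scal_part H' by [].
have eTs : anti_part H = anti_part H' by [].
have m1S : minus1 \in scal_part H'.
  by apply: nonsquare_minus1 nscd; apply: scal_part_mul.
have Sab := scal_part_mul symH Hh; have Tab := anti_part_div symH Hh.
have Scd := scal_part_mul symH' H'cd; have Tcd := anti_part_div symH' H'cd.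
rewrite /= eSs in Sab; rewrite /= eTs in Tab.
have sqab := squares_scal_anti Hh; rewrite /= eSs eTs in sqab.
have sqcd := squares_scal_anti H'cd; rewrite /= in sqcd.
(* With both invariants squares, diag(p, q) is diag(xy, x/y) or its negative; S contains -1. *)
have both p q : (p * q)%g \in squares (scal_part H') -> (p * q^-1)%g \in squares (anti_part H') ->
    dg p q \in H'.
  move=> /squaresP[x Sx ex] /squaresP[y Ty ey].
  have qe : (q = p^-1 * x ^+ 2)%g by rewrite -ex mulKg.
  have : (p ^+ 2 = (x * y) ^+ 2)%g.
    by rewrite [RHS]expgMn; [rewrite -ex -ey; ufield | apply: unitC].
  case/unit_sq_eq => pe; rewrite qe pe.
    have -> : ((x * y)^-1 * x ^+ 2 = x * y^-1)%g by ufield.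
    exact: mem_scal_anti.
  have -> : ((minus1 * (x * y))^-1 * x ^+ 2 = (minus1 * x) * y^-1)%g.
    by rewrite invMg minus1V; ufield.
  by rewrite mulgA mem_scal_anti // groupM.
have [sab|nab] := boolP ((a * b)%g \in squares (scal_part H')).
  by apply: both; rewrite -?sqab.
rewrite -(mulgK c a) -(mulgK d b) -dgM -dgV groupM ?groupV //.
apply: both.
  have -> : (a * c * (b * d) = a * b * (c * d))%g by ufield.
  by rewrite (squaresMl (S := scal_part_group H')) // (negPf nab) (negPf nscd).
have -> : (a * c * (b * d)^-1 = (a * b^-1) * (c * d^-1))%g by ufield.
by rewrite (squaresMl (S := anti_part_group H')) // -sqab -sqcd (negPf nab) (negPf nscd).
Qed.

Definition product_subgroup S T : {set GL} := [set dg (x * y)%g (x * y^-1)%g | x in S, y in T].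

Lemma product_subgroup_group_set S T : group_set (product_subgroup S T).
Proof.
apply/group_setP; split.
  by apply/imset2P; exists 1%g 1%g; rewrite ?group1 // invg1 mulg1 dg1.
move=> _ _ /imset2P[x y Sx Ty ->] /imset2P[x' y' Sx' Ty' ->].
apply/imset2P; exists (x * x')%g (y * y')%g; rewrite ?groupM // dgM.
by congr dg; ufield.
Qed.
Definition product_subgroup_group S T := Group (product_subgroup_group_set S T).

(** When S and T contain -1, this is the preimage under diag(a, b) |-> (ab, a/b) of
their fibre product over the group of order two. *)
Definition fibre_subgroup S T : {set GL} :=
  [set dg a b | a in [set: U], b in [set b | [&& (a * b)%g \in S, (a * b^-1)%g \in T
                       & ((a * b)%g \in squares S) == ((a * b^-1)%g \in squares T)]]].

Lemma mem_fibre_subgroup S T a b : (dg a b \in fibre_subgroup S T) =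
  [&& (a * b)%g \in S, (a * b^-1)%g \in T
    & ((a * b)%g \in squares S) == ((a * b^-1)%g \in squares T)].
Proof.
apply/imset2P/idP => [[c d _ ] | Pab]; last by exists a b; rewrite ?inE.
by rewrite inE => Pcd /dg_inj[-> ->].
Qed.

Lemma fibre_subgroup_group_set S T : group_set (fibre_subgroup S T).
Proof.
apply/group_setP; split.
  by rewrite -dg1 mem_fibre_subgroup mulg1 invg1 mulg1 !group1 !squares1.
move=> g g'; case/imset2P => a b _; rewrite inE => /and3P[Sab Tab /eqP eab] ->.
case/imset2P => c d _; rewrite inE => /and3P[Scd Tcd /eqP ecd] ->.
rewrite dgM mem_fibre_subgroup.
have -> : (a * c * (b * d) = a * b * (c * d))%g by ufield.
have -> : (a * c * (b * d)^-1 = (a * b^-1) * (c * d^-1))%g by ufield.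
by rewrite (groupM Sab Scd) (groupM Tab Tcd) (squaresMl Sab Scd) (squaresMl Tab Tcd) eab ecd eqxx.
Qed.
Definition fibre_subgroup_group S T := Group (fibre_subgroup_group_set S T).

(** H is the product of the groups that S and T define, and these share diag(-1, -1)
if -1 is in both, so the only constraint on (S, T) is that -1 lies in both or in
neither. The predicate P lets the same count serve for twistable groups. *)
Lemma card_product (P : pred {group U}) :
  #|[set H : {group GL} | [&& swap_stable H, is_product H & P (scal_part_group H)]]| =
  #|[set ST : UU | ((minus1 \in ST.1) == (minus1 \in ST.2)) && P ST.1]|.
Proof.
rewrite -(card_in_imset (f := scal_anti_parts)); last first.
  move=> H H'; rewrite !inE => /and3P[symH sp _] /and3P[symH' sp' _] e.
  by apply/val_inj/eqP; rewrite eqEsubset !product_parts_inj.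
apply: eq_card => -[S T]; rewrite [RHS]inE /=; apply/imsetP/andP.
  case=> H; rewrite inE => /and3P[symH sp PS] [-> ->]; split=> //.
  exact/eqP/minus1_scal_anti.
case=> /eqP e PS; pose H := product_subgroup_group S T.
have symH : swap_stable H.
  apply/swap_stableP; split.
    by apply/subsetP => _ /imset2P[x y _ _ ->]; apply: dg_diag.
  move=> a b /imset2P[x y Sx Ty /dg_inj[-> ->]]; apply/imset2P.
  by exists x (y^-1)%g; rewrite ?groupV ?invgK.
have eS : scal_part_group H = S.
  apply/val_inj/setP => a; rewrite /= inE; apply/imset2P/idP => [[x y Sx Ty]|Sa].
    case/dg_inj => -> /mulgI e2; have : (y ^+ 2 = 1)%g by rewrite expgS expg1 {2}e2 mulgV.
    case/unit_sq1 => y1; first by rewrite y1 mulg1.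
    by rewrite groupM // y1 e -y1.
  by exists a 1%g; rewrite ?group1 ?invg1 ?mulg1.
have eT : anti_part_group H = T.
  apply/val_inj/setP => a; rewrite /= inE; apply/imset2P/idP => [[x y Sx Ty]|Ta].
    case/dg_inj => ae; rewrite ae => e2; have : (x ^+ 2 = 1)%g.
      have -> : (x ^+ 2 = (x * y) * (x * y^-1))%g by ufield.
      by rewrite -e2 mulgV.
    case/unit_sq1 => x1; first by rewrite x1 mul1g.
    by rewrite groupM // x1 -e -x1.
  by exists 1%g a; rewrite ?group1 ?mul1g.
exists H; last by rewrite /scal_anti_parts eS eT.
rewrite inE symH eS PS andbT /=; apply/(det_set_squaresP symH) => a b.
case/imset2P => x y Sx Ty /dg_inj[-> ->]; rewrite eS; apply/squaresP; exists x => //.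
by ufield.
Qed.

(** For diag(a, b) outside the product, ab is a nonsquare of S and a/b one of T; their
product a^2 is a square of F_l^*, so they are squares of F_l^* both or neither.
Conversely such nonsquares u of S and v of T yield diag(a, u/a) with a^2 = uv. *)
Lemma card_nonproduct :
  #|[set H : {group GL} | swap_stable H && ~~ is_product H]| =
  #|[set ST : UU | [&& minus1 \in ST.1, minus1 \in ST.2
     & (ST.1 \subset squares [set: U]) == (ST.2 \subset squares [set: U])]]|.
Proof.
rewrite -(card_in_imset (f := scal_anti_parts)); last first.
  move=> H H'; rewrite !inE => /andP[symH sp] /andP[symH' sp'] e.
  by apply/val_inj/eqP; rewrite eqEsubset !nonproduct_parts_inj.
apply: eq_card => -[S T]; rewrite [RHS]inE /=; apply/imsetP/and3P.
  case=> H; rewrite inE => /andP[symH nsp] [-> ->].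
  have [a [b [Hab ns]]] := nonproduct_witness symH nsp.
  have Sab := scal_part_mul symH Hab; have Tab := anti_part_div symH Hab.
  have nt : (a * b^-1)%g \notin squares (anti_part H) by rewrite -(squares_scal_anti Hab).
  split; [exact: nonsquare_minus1 ns | exact: nonsquare_minus1 nt |].
  rewrite -(nonsquare_sub Sab ns) -(nonsquare_sub Tab nt).
  have -> : (a * b^-1 = a * b * (b^-1) ^+ 2)%g by ufield.
  rewrite (squaresMl (S := [set: U]%G) (y := ((b^-1) ^+ 2)%g)) ?in_setT //.
  have -> : ((b^-1) ^+ 2)%g \in squares [set: U]%G by apply/squaresP; exists (b^-1)%g; rewrite ?inE.
  by case: (_ \in _).
case=> mS mT /eqP e; pose H := fibre_subgroup_group S T.
have symH : swap_stable H.
  apply/swap_stableP; split.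
    by apply/subsetP => _ /imset2P[x y _ _ ->]; apply: dg_diag.
  move=> a b; rewrite !mem_fibre_subgroup (unitC b a).
  have -> : (b * a^-1 = (a * b^-1)^-1)%g by rewrite invMg invgK.
  rewrite groupV => /and3P[-> -> /eqP ->] /=; apply/eqP; apply/idP/idP; first exact: squaresV.
  by move/squaresV; rewrite invgK.
have sqm (R : {group U}) a : minus1 \in R -> ((a * a)%g \in squares R) = (a \in R).
  move=> mR; apply/squaresP/idP => [[x Rx] | Ra]; last by exists a.
  by case/unit_sq_eq => -> //; rewrite groupM.
have eS : scal_part_group H = S.
  apply/val_inj/setP => a; rewrite /= inE mem_fibre_subgroup mulgV group1 squares1 /=.
  rewrite sqm // eqb_id; case Sa: (a \in S); rewrite ?andbF //.
  by rewrite groupM.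
have eT : anti_part_group H = T.
  apply/val_inj/setP => a; rewrite /= inE mem_fibre_subgroup mulgV group1 squares1 /= invgK.
  rewrite sqm //; case Ta: (a \in T); rewrite ?andbF //.
  by rewrite groupM.
exists H; last by rewrite /scal_anti_parts eS eT.
rewrite inE symH /=; apply/negP => /(det_set_squaresP symH) sq.
have [u Su nu] := nonsquare_exists l_prime l_odd mS.
have [v Tv nv] := nonsquare_exists l_prime l_odd mT.
have : (u * v)%g \in squares [set: U].
  rewrite (squaresMl (S := [set: U]%G)) ?in_setT //.
  by rewrite (nonsquare_sub Su nu) (nonsquare_sub Tv nv) e.
case/squaresP => a _ auv; case/negP: (nu); rewrite -{1}(mulKVg a u) -{1}eS; apply: sq.
rewrite mem_fibre_subgroup mulKVg Su (negPf nu).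
have -> : (a * (a^-1 * u)^-1 = v)%g.
  by rewrite invMg invgK (unitC _ a) mulgA -[(a * a)%g]/(a ^+ 2)%g -auv (unitC u) mulgK.
by rewrite Tv (negPf nv).
Qed.

Lemma scalar_stable H : H \subset scalar_group l -> swap_stable H.
Proof.
move=> sZ; apply/swap_stableP; split; first exact: subset_trans sZ (scal_diag l).
by move=> a b Hab; have := subsetP sZ _ Hab; rewrite dg_scal => /eqP e; rewrite e in Hab *.
Qed.

Lemma scalar_product H : H \subset scalar_group l -> is_product H.
Proof. by move=> sZ; rewrite /is_product (setIidPl sZ). Qed.

Lemma card_scalar_subgroups (P : pred {group U}) :
  #|[set H : {group GL} | (H \subset scalar_group l) && P (scal_part_group H)]| =
  #|[set S : {group U} | P S]|.
Proof.
rewrite -(card_in_imset (f := fun H => scal_part_group H)); last first.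
  move=> H H'; rewrite !inE => /andP[sH _] /andP[sH' _] [e].
  have sub (K K' : {group GL}) : K \subset scalar_group l -> scal_part K = scal_part K' -> K \subset K'.
    move=> sK eK; apply/subsetP => k Kk; have /scalP[a ae] := subsetP sK k Kk.
    by move/setP/(_ a): eK; rewrite !inE -ae Kk.
  by apply/val_inj/eqP; rewrite eqEsubset (sub _ _ sH e) (sub _ _ sH' (esym e)).
apply: eq_card => S; rewrite [RHS]inE; apply/imsetP/idP => [[H]|PS].
  by rewrite inE => /andP[_ PS ->].
have grp : group_set ([set dg a a | a in S] : {set GL}).
  apply/group_setP; split; first by apply/imsetP; exists 1%g; rewrite ?dg1.
  move=> _ _ /imsetP[a Sa ->] /imsetP[b Sb ->]; apply/imsetP.
  by exists (a * b)%g; rewrite ?groupM ?dgM.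
have eS : scal_part_group (Group grp) = S.
  apply/val_inj/setP => a; rewrite /= inE; apply/imsetP/idP => [[b Sb /dg_inj[-> _]]//|Sa].
  by exists a.
exists (Group grp); last by rewrite eS.
rewrite inE eS PS andbT; apply/subsetP => _ /imsetP[a _ ->]; by rewrite dg_scal.
Qed.

(** The scalar part of such an H contains the nonsquare a^2 for any diag(a, -a) in H.
Conversely the elements diag(a, -a) with a^2 in S and a outside S are added to the
scalars of S; two such elements multiply to a scalar of S because the product of two
nonsquares is a square. *)
Lemma card_klein :
  #|[set H : {group GL} | [&& @admissible l H, klein H & D \notin H]]| =
  #|[set S : {group U} | (minus1 \in S) && (S \subset squares [set: U])]|.
Proof.
have nonscalar H : ~~ (H \subset scalar_group l) -> swap_stable H -> klein H ->
    exists a, dg a (minus1 * a)%g \in H.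
  move=> nsc symH /kleinP kH; have [a [b [ab Hab]]] := nonscalarP (sub_diag symH) nsc.
  by move: ab (Hab); case: (kH a b Hab) => ->; rewrite ?eqxx // => _ {}Hab; exists a.
rewrite -(card_in_imset (f := fun H => scal_part_group H)); last first.
  move=> H H'; rewrite !inE !admissibleE => /and3P[/andP[symH nsc] kH nD].
  move=> /and3P[/andP[symH' nsc'] kH' nD'] [e].
  have [a Ha] := nonscalar _ nsc symH kH; have [a' Ha'] := nonscalar _ nsc' symH' kH'.
  apply/val_inj/eqP; rewrite eqEsubset.
  by rewrite (klein_notmem_sub symH symH' kH nD nD' Ha') // (klein_notmem_sub symH' symH kH' nD' nD Ha).
apply: eq_card => S; rewrite [RHS]inE; apply/imsetP/andP => [[H]|[mS sS]].
  rewrite inE admissibleE => /and3P[/andP[symH nsc] kH nD] ->.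
  have [a Ha] := nonscalar _ nsc symH kH.
  have [mS _ a2 a2n] := klein_nonsquare symH nD Ha; split=> //.
  by rewrite -(nonsquare_sub a2 a2n); apply/squaresP; exists a; rewrite ?inE.
pose P a b := (a \in S) && (b == a) || [&& a \notin S, (a ^+ 2)%g \in S & b == (minus1 * a)%g].
pose A : {set GL} := [set dg a b | a in [set: U], b in [set b | P a b]].
have memA a b : (dg a b \in A) = P a b.
  apply/imset2P/idP => [[c d _ ] | Pab]; last by exists a b; rewrite ?inE.
  by rewrite inE => Pcd /dg_inj[-> ->].
have grp : group_set A.
  apply/group_setP; split; first by rewrite -dg1 memA /P group1 eqxx.
  move=> g g'; case/imset2P => a b _; rewrite inE => Pab ->.
  case/imset2P => c d _; rewrite inE => Pcd ->; rewrite dgM memA; rewrite /P in Pab Pcd *.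
  case/orP: Pab => [/andP[Sa /eqP->]|/and3P[nSa Sa2 /eqP->]];
    case/orP: Pcd => [/andP[Sc /eqP->]|/and3P[nSc Sc2 /eqP->]].
  - by rewrite groupM // eqxx.
  - rewrite groupMl // (negPf nSc) /= expgMn; last exact: unitC.
    by rewrite (groupM (groupX 2 Sa) Sc2) /=; apply/eqP; ufield.
  - rewrite groupMr // (negPf nSa) /= expgMn; last exact: unitC.
    by rewrite (groupM Sa2 (groupX 2 Sc)) /= mulgA eqxx.
  have nsq x : x \notin S -> (x ^+ 2)%g \notin squares S.
    by apply: contra => /squaresP[s Ss /unit_sq_eq[->|->]] //; rewrite groupM.
  have := nonsquareM (cyclic_unit S) Sa2 Sc2 (nsq _ nSa) (nsq _ nSc).
  rewrite -expgMn => [/squaresP[s Ss /unit_sq_eq e]|]; last exact: unitC.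
  have -> : (a * c)%g \in S by case: e => -> //; rewrite groupM.
  have -> : (minus1 * a * (minus1 * c) = a * c)%g by ufield.
  by rewrite eqxx.
pose H := Group grp.
have symH : swap_stable H.
  apply/swap_stableP; split.
    by apply/subsetP => _ /imset2P[x y _ _ ->]; apply: dg_diag.
  move=> a b; rewrite !memA /P => /orP[/andP[Sa /eqP->]|/and3P[nSa Sa2 /eqP->]].
    by rewrite Sa eqxx.
  rewrite groupMl // (negPf nSa) /= expgMn; last exact: unitC.
  by rewrite minus1_sq mul1g Sa2 mulgA minus1M mul1g eqxx.
have eS : scal_part_group H = S.
  apply/val_inj/setP => a; rewrite /= inE memA /P eqxx andbT.
  by rewrite [a == _]eq_sym (negPf (minus1_neq l_prime l_odd a)) !andbF orbF.
exists H; last by rewrite eS.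
rewrite inE admissibleE symH memA /P group1 (negPf (minus1_neq1 l_prime l_odd)) /= andbT.
apply/andP; split.
  have [u Su nu] := nonsquare_exists l_prime l_odd mS.
  have /squaresP[a _ ua] := subsetP sS u Su.
  have nSa : a \notin S by apply: contra nu => Sa; rewrite ua; apply/squaresP; exists a.
  apply/(nonscalarP (sub_diag symH)); exists a, (minus1 * a)%g.
  by rewrite eq_sym minus1_neq // memA /P -ua Su (negPf nSa) eqxx.
apply/(kleinP H) => a b; rewrite memA => /orP[/andP[_ /eqP->]|/and3P[_ _ /eqP->]]; by [left|right].
Qed.

End Counting.

(** * Divisor counts *)

Section Divisors.
Local Open Scope nat_scope.

Lemma size_add_divisors f s : size (PrimeDecompAux.add_divisors f s) = f.2.+1 * size s.
Proof.
case: f => p e /=; elim: e => [|e IH]; first by rewrite mul1n.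
by rewrite iterS size_merge size_cat size_map IH [e.+2 * _]mulSn addnC.
Qed.

(** Each prime power p^e multiplies the number of divisors found so far by e + 1. *)
Lemma tau_prod n : tau n = \prod_(p <- primes n) (logn p n).+1.
Proof.
rewrite /tau /divisors prime_decompE.
elim: (primes n) => [|p s IH]; first by rewrite big_nil.
by rewrite [LHS]size_add_divisors IH big_cons.
Qed.

Lemma logn_odd_part i m p : odd m -> p != 2 -> logn p (2 ^ i * m) = logn p m.
Proof.
move=> om p2; have m0 : 0 < m by case: m om.
rewrite lognM ?expn_gt0 // lognX logn_prime // eq_sym.
by rewrite [2 == p]eq_sym (negPf p2) muln0.
Qed.

Lemma logn2_odd_part i m : odd m -> logn 2 (2 ^ i * m) = i.
Proof.
move=> om; have m0 : 0 < m by case: m om.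
rewrite lognM ?expn_gt0 // lognX logn_prime // eqxx muln1.
by rewrite (@logn_coprime 2 m) ?addn0 // coprime2n.
Qed.

Lemma perm_primes_odd_part i m : odd m ->
  perm_eq (primes (2 ^ i.+1 * m)) (2 :: primes m).
Proof.
move=> om; have m0 : 0 < m by case: m om.
apply: uniq_perm; rewrite ?primes_uniq //=.
  by rewrite primes_uniq andbT mem_primes dvdn2 om m0 !andbF.
by move=> p; rewrite primesM ?expn_gt0 // primesX // primes_prime // !inE.
Qed.

Lemma mem_primes_odd m p : odd m -> p \in primes m -> p != 2.
Proof.
by move=> om; rewrite mem_primes => /and3P[_ _ dv]; apply: contraTneq dv => ->; rewrite dvdn2 om.
Qed.

Lemma tau_odd_part i m : odd m -> tau (2 ^ i * m) = i.+1 * tau m.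
Proof.
move=> om; case: i => [|i]; first by rewrite !mul1n.
rewrite !tau_prod (perm_big _ (perm_primes_odd_part i om)) big_cons logn2_odd_part //.
congr (_ * _); apply: eq_big_seq => p /(mem_primes_odd om) p2.
by rewrite logn_odd_part.
Qed.

Lemma beta_odd_part i m : odd m ->
  beta (2 ^ i.+1 * m) = (2 * (i.+1 ^ 2 - i.+1) + 3) * tau m ^ 2.
Proof.
move=> om; rewrite /beta /beta2 logn2_odd_part // oddM oddX /=; congr (_ * _).
rewrite (perm_big _ (perm_primes_odd_part i om)) big_cons eqxx /=.
rewrite tau_prod -mulnn -big_split big_seq_cond [RHS]big_seq.
apply: eq_big => [p|p /andP[_ p2]]; last by rewrite logn_odd_part // mulnn.
by case pm: (p \in primes m) => //=; rewrite (mem_primes_odd om pm).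
Qed.

(** Division by two is a bijection onto the divisors of n / 2c. *)
Lemma count_even_divisors c n : 0 < n -> 0 < c ->
  count (fun d => (2 %| d) && (c * d %| n)) (divisors n) =
  if 2 * c %| n then tau (n %/ (2 * c)) else 0.
Proof.
move=> n0 c0; case: ifP => dn; last first.
  apply/eqP; rewrite -leqn0 leqNgt -has_count; apply/hasPn => d _.
  apply: contraFN dn => /andP[/dvdnP[d' ->] cd].
  by apply: dvdn_trans cd; rewrite mulnCA dvdn_mull // mulnC.
rewrite /tau -size_filter -(size_map (muln 2) (divisors _)).
have q0 : 0 < n %/ (2 * c) by rewrite divn_gt0 ?muln_gt0 // dvdn_leq.
apply/perm_size/uniq_perm.
- by rewrite filter_uniq ?divisors_uniq.
- by rewrite map_inj_uniq ?divisors_uniq // => x y /eqP; rewrite eqn_pmul2l // => /eqP.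
move=> d; rewrite mem_filter -dvdn_divisors //; apply/idP/mapP.
  case/andP=> /andP[/dvdnP[d' ->] cd] _; exists d'; last by rewrite mulnC.
  by rewrite -dvdn_divisors // dvdn_divRL // [_ * (2 * c)]mulnA mulnC.
case=> d'; rewrite -dvdn_divisors // dvdn_divRL // => cd ->.
have e : c * (2 * d') = d' * (2 * c) by rewrite mulnA [c * 2]mulnC mulnC.
have dvd : 2 * d' %| n by apply: dvdn_trans cd; rewrite -e dvdn_mull.
by rewrite e cd dvd dvdn_mulr.
Qed.

End Divisors.

(** * Cardinalities *)

Section Total.
Variable l : nat.
Hypotheses (l_prime : prime l) (l_odd : odd l).
Notation U := (unitFp l).
Notation GL := (GL2 l).
Notation minus1 := (minus1 l).
Notation D := (dg 1%g minus1).
Notation UU := ({group U} * {group U})%type.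
Implicit Types (H : {group GL}) (S T : {group U}) (a b c d x y u : U).

Definition odd_subgroups : {set {group U}} := [set S : {group U} | minus1 \notin S].
Definition even_subgroups : {set {group U}} := [set S : {group U} | minus1 \in S].
Definition square_subgroups : {set {group U}} :=
  [set S : {group U} | (minus1 \in S) && (S \subset squares [set: U])].
Definition nonsquare_subgroups : {set {group U}} :=
  [set S : {group U} | (minus1 \in S) && ~~ (S \subset squares [set: U])].

Lemma card_stable :
  #|[set H : {group GL} | swap_stable H]| =
  (#|odd_subgroups| ^ 2 + #|even_subgroups| ^ 2
   + #|square_subgroups| ^ 2 + #|nonsquare_subgroups| ^ 2)%N.
Proof.
rewrite -(cardsID [set H : {group GL} | is_product H]).
have -> : [set H : {group GL} | swap_stable H] :&: [set H | is_product H] =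
    [set H : {group GL} | [&& swap_stable H, is_product H & predT (scal_part_group H)]].
  by apply/setP => H; rewrite !inE andbT.
have -> : [set H : {group GL} | swap_stable H] :\: [set H | is_product H] =
    [set H : {group GL} | swap_stable H && ~~ is_product H].
  by apply/setP => H; rewrite !inE andbC.
rewrite (card_product predT) // card_nonproduct // -addnA -!mulnn -!cardsX; congr (_ + _)%N.
  rewrite -cardsUI [X in (_ + X)%N]eq_card0 ?addn0; last first.
    by move=> [S T]; rewrite !inE /=; case: (minus1 \in S); rewrite ?andbF.
  apply: eq_card => -[S T]; rewrite !inE /= andbT.
  by case: (minus1 \in S); case: (minus1 \in T).
rewrite -cardsUI [X in (_ + X)%N]eq_card0 ?addn0; last first.
  by move=> [S T]; rewrite !inE /=; case: (S \subset _); rewrite ?andbF.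
apply: eq_card => -[S T]; rewrite !inE /=.
by case: (minus1 \in S); case: (minus1 \in T); case: (S \subset _); case: (T \subset _).
Qed.

(** The scalar groups have to be removed from the swap-stable ones. *)
Lemma card_admissible :
  (#|[set H : {group GL} | @admissible l H]| + (#|odd_subgroups| + #|even_subgroups|) =
   #|odd_subgroups| ^ 2 + #|even_subgroups| ^ 2
   + #|square_subgroups| ^ 2 + #|nonsquare_subgroups| ^ 2)%N.
Proof.
rewrite -card_stable addnC.
rewrite -[in RHS](cardsID [set H : {group GL} | H \subset scalar_group l]).
congr (_ + _)%N; last first.
  by apply: eq_card => H; rewrite !inE admissibleE andbC.
have -> : (#|odd_subgroups| + #|even_subgroups| = #|[set S : {group U} | predT S]|)%N.
  rewrite addnC -(cardsID even_subgroups [set S | predT S]); congr (_ + _)%N.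
    by apply: eq_card => S; rewrite !inE.
  by apply: eq_card => S; rewrite !inE andbT.
rewrite -(card_scalar_subgroups predT); apply: eq_card => H; rewrite !inE andbT.
by apply/idP/andP => [sZ | [] //]; rewrite scalar_stable.
Qed.

(** The admissible twistable groups are the nonscalar products whose scalar part
contains -1, and every scalar group is a product. *)
Lemma card_twistable :
  (#|[set H : {group GL} | @admissible l H && @twistable l H]| + #|even_subgroups| =
   #|even_subgroups| ^ 2)%N.
Proof.
have -> : (#|even_subgroups| ^ 2 = #|[set H : {group GL} | [&& swap_stable H, is_product H
    & minus1 \in scal_part_group H]]|)%N.
  rewrite (card_product (fun S : {group U} => minus1 \in S)) -mulnn -cardsX.
  by apply: eq_card => -[S T]; rewrite !inE /=; case: (minus1 \in S); rewrite ?andbT ?andbF.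
rewrite -[in RHS](cardsID [set H : {group GL} | H \subset scalar_group l]) addnC.
congr (_ + _)%N; last first.
  apply: eq_card => H; rewrite !inE admissibleE /twistable dg_neg_one.
  by case: (H \subset scalar_group l); rewrite /= ?andbF ?andbT.
rewrite -(card_scalar_subgroups (fun S : {group U} => minus1 \in S)); apply: eq_card => H.
rewrite !inE; case sZ: (H \subset scalar_group l); rewrite ?andbF //= andbT.
by rewrite scalar_stable // scalar_product.
Qed.

End Total.

(** * Evaluation and the main theorem *)

Section Values.
Variable l : nat.
Hypotheses (l_prime : prime l) (l_odd : odd l).
Notation U := (unitFp l).
Notation minus1 := (minus1 l).

Lemma pred_gt0 : (0 < l.-1)%N.
Proof. by have := odd_prime_gt2 l_odd l_prime; case: (l) => [|[|]]. Qed.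

Lemma card_subgroups_unit (P : pred nat) :
  #|[set S : {group U} | P #|S|]| = count P (divisors l.-1).
Proof. by rewrite (card_subgroups (cyclic_unit [set: U]%G)) card_unitFp. Qed.

Lemma card_odd_even : (#|odd_subgroups l| + #|even_subgroups l| = tau l.-1)%N.
Proof.
rewrite /tau -count_predT -card_subgroups_unit addnC.
rewrite -[in RHS](cardsID (even_subgroups l)); congr (_ + _)%N.
  by apply: eq_card => S; rewrite !inE.
by apply: eq_card => S; rewrite !inE andbT.
Qed.

Lemma card_even : #|even_subgroups l| = tau (l.-1 %/ 2).
Proof.
have -> : #|even_subgroups l| = #|[set S : {group U} | (2 %| #|S|)%N]|.
  by apply: eq_card => S; rewrite !inE minus1_even.
have := count_even_divisors pred_gt0 (isT : (0 < 1)%N); rewrite muln1 even_pred // => <-.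
rewrite card_subgroups_unit; apply: eq_in_count => d.
by rewrite -dvdn_divisors ?pred_gt0 // mul1n => ->; rewrite andbT.
Qed.

Lemma card_square :
  #|square_subgroups l| = if (4 %| l.-1)%N then tau (l.-1 %/ 4) else 0%N.
Proof.
rewrite -[4%N]/(2 * 2)%N -(count_even_divisors pred_gt0 (isT : (0 < 2)%N)).
rewrite -card_subgroups_unit; apply: eq_card => S.
by rewrite !inE minus1_even // sub_squares.
Qed.

Lemma card_nonsquare : (#|square_subgroups l| + #|nonsquare_subgroups l| = #|even_subgroups l|)%N.
Proof.
rewrite -[in RHS](cardsID [set S : {group U} | S \subset squares [set: U]]).
by congr (_ + _)%N; apply: eq_card => S; rewrite !inE // andbC.
Qed.

(** Apply the criterion for consisting of squares to the subgroup of order two. *)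
Lemma legendre_minus1 : legendre (-1) l = if (4 %| l.-1)%N then 1 else -1.
Proof.
have sq : [exists x : 'F_l, x ^+ 2 == (-1)%:~R] = (4 %| l.-1)%N.
  have := sub_squares l_prime l_odd <[minus1]>%G.
  rewrite -orderE minus1_order // => <-.
  have nsq := @generator_nonsquare l l_prime l_odd <[minus1]>%G minus1 (cycle_id minus1) erefl.
  rewrite -(nonsquare_sub (cycle_id minus1 : minus1 \in <[minus1]>%G) nsq).
  apply/existsP/squaresP => [[x /eqP xx]|[y _ ym]].
    have ux : x \is a GRing.unit.
      have : x ^+ 2 \is a GRing.unit by rewrite xx rmorphN1 unitrN1.
      by rewrite unitrX_pos.
    exists (FinRing.unit _ ux); rewrite ?inE //; apply: val_inj => /=.
    by rewrite -[x * x]/(x ^+ 2) xx rmorphN1.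
  by exists (val y); rewrite rmorphN1 -[val y ^+ 2]/(val (y ^+ 2)%g) -ym.
rewrite /legendre sq rmorphN1 oppr_eq0 oner_eq0.
by [].
Qed.

(** With l - 1 = 2^(i+1) m and m odd, the four cardinalities are tau m times 1, i + 1,
i and 1. *)
Lemma beta_sum_squares :
  (beta l.-1 = #|odd_subgroups l| ^ 2 + #|even_subgroups l| ^ 2
   + #|square_subgroups l| ^ 2 + #|nonsquare_subgroups l| ^ 2)%N.
Proof.
have [m /= com nm] := pfactor_coprime (isT : prime 2) pred_gt0.
have om : odd m by move: com; rewrite coprime2n.
have : (0 < logn 2 l.-1)%N by rewrite logn_gt0 mem_primes pred_gt0 even_pred.
case: (logn 2 l.-1) nm => // i nm _; rewrite mulnC in nm.
have ce : #|even_subgroups l| = (i.+1 * tau m)%N.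
  by rewrite card_even nm expnS -mulnA mulKn // tau_odd_part.
have co : #|odd_subgroups l| = tau m.
  have := card_odd_even; rewrite ce nm tau_odd_part // [(i.+2 * _)%N]mulSn.
  by move/addIn.
have cs : #|square_subgroups l| = (i * tau m)%N.
  rewrite card_square nm; case: (i) => [|j].
    rewrite mul0n expn1 ifN // -[4%N]/(2 * 2)%N dvdn_pmul2l // dvdn2 om //.
  by rewrite !expnS !mulnA -!mulnA mulnA dvdn_mulr // mulKn // tau_odd_part.
have cn : #|nonsquare_subgroups l| = tau m.
  by have := card_nonsquare; rewrite ce cs mulSnr => /addnI.
rewrite nm beta_odd_part // ce co cs cn.
have -> : (i.+1 ^ 2 - i.+1 = i.+1 * i)%N by rewrite -mulnn -[X in (_ - X)%N]muln1 -mulnBr subn1.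
ring.
Qed.

End Values.

(** The determinant identifies the quotient with F_l^*. *)
Lemma delta_det_generator l (d1 d2 : unitFp l) (K := (diag_cartan l :&: SL2 l : {set GL2 l})%g) :
  generator ((diag_cartan l : {set GL2 l}) / K)%g (coset K (dg d1 d2)) ->
  <[d1 * d2]>%g = [set: unitFp l].
Proof.
set Kg : {group GL2 l} := (diag_cartan_group l :&: SL2_group l)%G.
rewrite /generator => /eqP defD.
have nK : diag_cartan l \subset 'N(Kg)%g.
  by apply: sub_abelian_norm; [apply: diag_abelian | apply: subsetIl].
apply/setP => u; rewrite inE; apply/idP.
have : coset Kg (dg u 1) \in <[coset Kg (dg d1 d2)]>%g.
  by rewrite -defD mem_quotient // dg_diag.
case/cycleP => k; rewrite -morphX ?(subsetP nK) ?dg_diag //= dgX.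
move/rcoset_kercosetP; rewrite !(subsetP nK) ?dg_diag // => /(_ isT isT).
rewrite mem_rcoset dgV dgM in_setI => /andP[_].
rewrite inE det_dg => /eqP e.
have -> : u = ((d1 * d2) ^+ k)%g; last exact: mem_cycle.
have {}e : (u * (d1 ^+ k)^-1 * (1 * (d2 ^+ k)^-1) = 1)%g by apply: val_inj.
rewrite expgMn; last exact: unitC.
by rewrite -[RHS]mul1g -e; ufield.
Qed.

Theorem corollary3p18 (l : nat) (l_prime : prime l) (l_odd : odd l)
    (delta : {'GL_2(l)}) (delta_diag : delta \in diag_cartan l)
    (delta_gen : generator (diag_cartan l / (diag_cartan l :&: SL2 l))%g
                           (coset (diag_cartan l :&: SL2 l)%g delta)) :
  [/\ (forall H : {group {'GL_2(l)}}, admissible H ->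
        [/\ G1 H \subset diag_cartan_plus l,
            H :=: (G1 H :&: diag_cartan l)%g
          & det_set H = neg_det_set (G1 H :\: H)]),
      (forall H : {group {'GL_2(l)}}, admissible H -> twistable H ->
        [/\ G2 delta H \subset diag_cartan_plus l,
            H :=: (G2 delta H :&: diag_cartan l)%g
          & [disjoint det_set H & neg_det_set (G2 delta H :\: H)]]),
      (forall G : {group {'GL_2(l)}},
        in_split_cartan_normalizer G && has_dihedral_image G <->
        exists2 H : {group {'GL_2(l)}}, admissible H &
          exists x : {'GL_2(l)},
            G :=: (G1 H :^ x)%g \/ twistable H /\ G :=: (G2 delta H :^ x)%g)
    & #|[set (G :^: [set: {'GL_2(l)}])%g | G : {group {'GL_2(l)}}
          & in_split_cartan_normalizer G && has_dihedral_image G]|%:R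
      = (beta l.-1)%:R - (tau l.-1)%:R + (tau (l.-1 %/ 2))%:R ^+ 2
        - (tau (l.-1 %/ 2))%:R
        - 1 / 2 * (1 + (legendre (-1) l)%:~R) * (tau (l.-1 %/ 4))%:R :> rat].
Proof.
have [d1 [d2 de]] := diagP _ delta_diag; subst delta.
have gen := delta_det_generator delta_gen.
split.
- move=> H; rewrite (@admissibleE l H) => /andP[symH _].
  have [sP eH _] := G1_ext symH; split=> //; exact: det_G1.
- move=> H; rewrite (@admissibleE l H) => /andP[symH _] tw.
  have [sP eH _] := G2_ext l_prime gen symH; split=> //; exact: (det_G2 l_prime l_odd gen).
- move=> G; split.
    move/(@split_dihedralP l l_prime l_odd G) => [L [z [xL eG]]].
    have [p [y [Pp eL _]]] := proper_ext_class l_prime l_odd gen xL.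
    move: Pp; rewrite inE => /andP[adm tw]; exists p.1 => //.
    exists (y * z : GL2 l)%g; move: tw eL; rewrite /extension.
    by case: p.2 => /= [tw|_] eL; [right; split=> // | left]; rewrite conjsgM -eL.
  case=> H adm [x eG]; apply/(@split_dihedralP l l_prime l_odd G).
  have xf b : (H, b) \in pairs l -> proper_ext (extension d1 d2 (H, b)).
    by move/(extension_facts l_prime gen) => [].
  case: eG => [eG|[tw eG]].
    by exists (G1 H), x; split=> //; apply: (xf false); rewrite inE /= adm.
  by exists (G2 (dg d1 d2) H), x; split=> //; apply: (xf true); rewrite inE /= adm.
have e1 := card_classes l_prime l_odd gen.
have e2 := card_pairs l.
have e3 := card_admissible l_prime l_odd.
have e4 := card_twistable l.
rewrite (card_klein l_prime l_odd) in e2.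
have e3' := etrans e3 (esym (beta_sum_squares l_prime l_odd)).
rewrite card_odd_even // in e3'; rewrite card_even // in e4.
have -> : 1 / 2 * (1 + (legendre (-1) l)%:~R) * (tau (l.-1 %/ 4))%:R
    = #|square_subgroups l|%:R :> rat.
  by rewrite legendre_minus1 // card_square //; case: ifP => _; field.
have e5 : #|pairs l :\: redundant l|%:R + #|square_subgroups l|%:R =
    (beta l.-1)%:R - (tau l.-1)%:R + ((tau (l.-1 %/ 2))%:R ^+ 2 - (tau (l.-1 %/ 2))%:R) :> rat.
  by rewrite -natrX -e3' -e4 !natrD !addrK -!natrD e2.
rewrite -[X in _ = X - _]addrA -e5 addrK.
exact: (congr1 (fun k : nat => k%:R : rat) e1).
Qed.
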